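(* Let $\mu_0,\mu_1\in\mathcal M(\Omega)$, let $\lambda_0,\lambda_1\in\mathcal M_2(\mathfrak C_\Omega)$ be optimal lifts of $\mu_0,\mu_1$ and let $\gamma\in\mathcal M_2(\mathfrak C_\Omega\times\mathfrak C_\Omega)$ be an associated optimal transport plan. Then the curve $$\mu(s):=\mathfrak P\lambda(s),\qquad\lambda(s):=Z(s;\cdot,\cdot)_\#\gamma,\qquad s\in[0,1],$$ is a constant-speed geodesic with respect to $\mathsf{HK}$, i.e. $$\mathsf{HK}(\mu(s),\mu(t))=|t-s|\,\mathsf{HK}(\mu_0,\mu_1)\quad\text{for all }0\le s<t\le1.$$
   Context: $\Omega\subset\mathbb R^d$ is convex and compact; $\mathcal M(\Omega)$ is the set of finite nonnegative Borel measures on $\Omega$. The cone over $\Omega$ is $\mathfrak C_\Omega:=(\Omega\times[0,\infty[)/(\Omega\times\{0\})$, with points $[x,r]$ and tip $\mathfrak o=[x,0]$, and metric $\mathsf d_{\mathfrak C}([x_0,r_0],[x_1,r_1])^2=r_0^2+r_1^2-2r_0r_1\cos_\pi(|x_0-x_1|)$, $\cos_\pi(L)=\cos(\min\{L,\pi\})$. $\mathcal M_2$ denotes finite nonnegative Borel measures with finite second moment (with respect to $r$, i.e. the distance to the tip). $\mathsf W_{\mathfrak C}(\lambda_0,\lambda_1)^2=\inf\iint\mathsf d_{\mathfrak C}^2\,\mathrm d\gamma$ over nonnegative measures $\gamma$ on $\mathfrak C_\Omega\times\mathfrak C_\Omega$ with marginals $\lambda_0,\lambda_1$ ($=\infty$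 if the masses differ). The projection $\mathfrak P:\mathcal M_2(\mathfrak C_\Omega)\to\mathcal M(\Omega)$ is given by $\int_\Omega\phi\,\mathrm d\mathfrak P\lambda=\int r^2\phi(x)\,\mathrm d\lambda([x,r])$, $\phi\in\mathrm C^0(\Omega)$; $\lambda$ is a lift of $\mu$ if $\mathfrak P\lambda=\mu$. The Hellinger–Kantorovich distance is $\mathsf{HK}(\mu_0,\mu_1)=\min\{\mathsf W_{\mathfrak C}(\lambda_0,\lambda_1)\mid\mathfrak P\lambda_j=\mu_j\}$. Optimal lifts are minimizers $(\lambda_0,\lambda_1)$ of this problem; an associated optimal plan is an optimal $\gamma$ for $\mathsf W_{\mathfrak C}(\lambda_0,\lambda_1)$. $Z(s;z_0,z_1)=[X(s;z_0,z_1),R(s;z_0,z_1)]$, $s\in[0,1]$, is the unique constant-speed minimal geodesic in $(\mathfrak C_\Omega,\mathsf d_{\mathfrak C})$ from $z_0=[x_0,r_0]$ to $z_1=[x_1,r_1]$: $R^2=(1-s)^2r_0^2+s^2r_1^2+2s(1-s)r_0r_1\cos_\pi(|x_0-x_1|)$, $X=(1-\rho)x_0+\rho x_1$, where for $0<|x_0-x_1|<\pi$, $\rho=\frac1{|x_1-x_0|}\arccos\big(\frac{(1-s)r_0+sr_1\cos|x_1-x_0|}{R}\big)$ (when $R>0$), and for $|x_0-x_1|\ge\pi$, $\rho=0$ while $(1-s)r_0>sr_1$ and $\rho=1$ when $(1-s)r_0<sr_1$. *)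

(* Defs.v *)
From HB Require Import structures.
From mathcomp Require Import all_boot all_order all_algebra.
From mathcomp Require Import all_classical all_reals all_analysis.
From mathcomp Require Import measurable_realfun.
From mathcomp Require Import ring lra.

Set Implicit Arguments.
Unset Strict Implicit.
Unset Printing Implicit Defensive.

Import Order.TTheory GRing.Theory Num.Theory.
Import numFieldNormedType.Exports.

Local Open Scope classical_set_scope.
Local Open Scope ring_scope.

Section euclidean.
Context {R : realType}.

(* The library norm on 'rV[R]_d is the sup norm; the cone metric uses the
   Euclidean one. *)
Definition enorm (d : nat) (v : 'rV[R]_d) : R := Num.sqrt (\sum_i v 0 i ^+ 2).

Lemma sqrtr_le_add (a b c : R) : 0 <= a -> 0 <= b -> c ^+ 2 <= a * b ->
  Num.sqrt (a + b + c *+ 2) <= Num.sqrt a + Num.sqrt b.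
Proof.
move=> a0 b0 cab; rewrite -[leRHS]ger0_norm ?addr_ge0 ?sqrtr_ge0//.
rewrite -sqrtr_sqr ler_wsqrtr// sqrrD !sqr_sqrtr// -sqrtrM//.
rewrite [leRHS]addrAC lerD2l lerMn2r/=.
by rewrite (le_trans (ler_norm c))// -sqrtr_sqr ler_wsqrtr.
Qed.

Lemma cauchy_schwarz (d : nat) (u v : 'rV[R]_d) :
  (\sum_i u 0 i * v 0 i) ^+ 2 <= (\sum_i u 0 i ^+ 2) * (\sum_i v 0 i ^+ 2).
Proof.
set a := \sum_i u 0 i ^+ 2; set b := \sum_i v 0 i ^+ 2.
set c := \sum_i _.
have a0 : 0 <= a by apply: sumr_ge0 => i _; exact: sqr_ge0.
have b0 : 0 <= b by apply: sumr_ge0 => i _; exact: sqr_ge0.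
have : 0 <= \sum_i (b * u 0 i - c * v 0 i) ^+ 2.
  by apply: sumr_ge0 => i _; exact: sqr_ge0.
have -> : \sum_i (b * u 0 i - c * v 0 i) ^+ 2 = b * (a * b - c ^+ 2).
  have E (k l : R) : \sum_i (k * u 0 i - l * v 0 i) ^+ 2 =
      k ^+ 2 * a - 2 * k * l * c + l ^+ 2 * b.
    rewrite /a /b /c !mulr_sumr -sumrB -big_split/=.
    by apply: eq_bigr => i _; ring.
  by rewrite E; ring.
move=> h; have [b_gt0|] := ltP 0 b.
  by rewrite pmulr_rge0// subr_ge0 in h.
move=> b_le0; have b_eq0 : b = 0 by apply/le_anti; rewrite b_le0.
have v0 i : v 0 i = 0.
  apply/eqP; rewrite -sqrf_eq0; move/eqP: b_eq0.
  rewrite /b psumr_eq0; last by move=> j _; exact: sqr_ge0.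
  by move/allP => /(_ i); rewrite mem_index_enum/=; apply.
rewrite b_eq0 mulr0 /c big1 ?expr0n// => i _.
by rewrite v0 mulr0.
Qed.

Lemma enorm_ge0 d (v : 'rV[R]_d) : 0 <= enorm v.
Proof. exact: sqrtr_ge0. Qed.

Lemma enormN d (v : 'rV[R]_d) : enorm (- v) = enorm v.
Proof. by rewrite /enorm; under eq_bigr do rewrite mxE sqrrN. Qed.

Lemma enormD d (u v : 'rV[R]_d) : enorm (u + v) <= enorm u + enorm v.
Proof.
rewrite /enorm.
have -> : \sum_i (u + v) 0 i ^+ 2 =
  \sum_i u 0 i ^+ 2 + \sum_i v 0 i ^+ 2 + (\sum_i u 0 i * v 0 i) *+ 2.
  rewrite -sumrMnl -!big_split/=; apply: eq_bigr => i _.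
  by rewrite mxE sqrrD addrAC.
apply: sqrtr_le_add; last exact: cauchy_schwarz.
- by apply: sumr_ge0 => i _; exact: sqr_ge0.
- by apply: sumr_ge0 => i _; exact: sqr_ge0.
Qed.

Lemma ler_enorm d (v : 'rV[R]_d) i : `|v 0 i| <= enorm v.
Proof.
rewrite -sqrtr_sqr ler_wsqrtr// (bigD1 i)//= lerDl.
by apply: sumr_ge0 => j _; exact: sqr_ge0.
Qed.

Lemma enorm_eq0 d (v : 'rV[R]_d) : enorm v = 0 -> v = 0.
Proof.
move=> v0; apply/rowP => i; rewrite mxE; apply/normr0_eq0/le_anti.
by rewrite normr_ge0 andbT -v0 ler_enorm.
Qed.

Lemma enorm0 d : enorm (0 : 'rV[R]_d) = 0.
Proof. by rewrite /enorm big1 ?sqrtr0// => i _; rewrite mxE expr0n. Qed.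

Lemma enorm_le_sum d (v : 'rV[R]_d) : enorm v <= \sum_i `|v 0 i|.
Proof.
have S0 : 0 <= \sum_i `|v 0 i| by exact: sumr_ge0.
rewrite -[leRHS]ger0_norm// -sqrtr_sqr ler_wsqrtr// expr2 big_distrl/=.
apply: ler_sum => i _; rewrite -real_normK ?num_real// expr2 ler_wpM2l//.
by rewrite (bigD1 i)//= lerDl sumr_ge0.
Qed.

Definition cos_pi (L : R) : R := cos (Num.min L pi).

(* Squared cone distance of [x0, r0] and [x1, r1] when L = |x0 - x1|. *)
Definition cone_dist_sq (r0 r1 L : R) : R :=
  r0 ^+ 2 + r1 ^+ 2 - 2 * r0 * r1 * cos_pi L.

Lemma cos_pi_le1 L : cos_pi L <= 1.
Proof. exact: cos_le1. Qed.

Lemma cos_pi_geN1 L : -1 <= cos_pi L.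
Proof. exact: cos_geN1. Qed.

Lemma ler_cos_0pi (a b : R) : 0 <= a -> b <= pi -> a <= b -> cos b <= cos a.
Proof.
move=> a0 bpi ab; have api := le_trans ab bpi; have b0 := le_trans a0 ab.
by rewrite leNgt ltr_cos ?in_itv/= ?a0 ?bpi ?api ?b0// -leNgt.
Qed.

Lemma cos_pi_decr L M : 0 <= L -> L <= M -> cos_pi M <= cos_pi L.
Proof.
move=> L0 LM; apply: ler_cos_0pi.
- by rewrite le_min L0 pi_ge0.
- by rewrite ge_min lexx orbT.
- by rewrite le_min !ge_min LM lexx orbT.
Qed.

Lemma cos_pi_lt1 L : 0 < L -> cos_pi L < 1.
Proof.
move=> L0; rewrite /cos_pi -[ltRHS]cos0 ltr_cos ?in_itv/= ?lexx ?pi_ge0//.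
  by rewrite lt_min L0 pi_gt0.
by rewrite le_min ltW// pi_ge0 ge_min lexx orbT.
Qed.

Lemma cos_pi0 : cos_pi 0 = 1.
Proof. by rewrite /cos_pi min_l ?pi_ge0// cos0. Qed.

Lemma cone_dist_sqE r0 r1 L : cone_dist_sq r0 r1 L =
  (r0 - r1) ^+ 2 + 2 * (r0 * r1) * (1 - cos_pi L).
Proof. by rewrite /cone_dist_sq; ring. Qed.

Lemma cone_dist_sq_ge0 r0 r1 L : 0 <= r0 -> 0 <= r1 -> 0 <= cone_dist_sq r0 r1 L.
Proof.
move=> r00 r10; rewrite cone_dist_sqE addr_ge0 ?sqr_ge0//.
by rewrite mulr_ge0 ?mulr_ge0// subr_ge0 cos_pi_le1.
Qed.

Lemma planar_triangle (r0 r1 r2 a b : R) :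
  Num.sqrt (r0 ^+ 2 + r2 ^+ 2 - 2 * r0 * r2 * cos (a + b)) <=
  Num.sqrt (r0 ^+ 2 + r1 ^+ 2 - 2 * r0 * r1 * cos a) +
  Num.sqrt (r1 ^+ 2 + r2 ^+ 2 - 2 * r1 * r2 * cos b).
Proof.
have ha := cos2Dsin2 a; have hb := cos2Dsin2 b.
pose x := r0 * cos a - r1; pose y := r0 * sin a.
pose x' := r1 - r2 * cos b; pose y' := r2 * sin b.
have -> : r0 ^+ 2 + r1 ^+ 2 - 2 * r0 * r1 * cos a = x ^+ 2 + y ^+ 2.
  transitivity (r0 ^+ 2 * (cos a ^+ 2 + sin a ^+ 2) + r1 ^+ 2 - 2 * r0 * r1 * cos a);
    first by rewrite ha mulr1.
  by rewrite /x /y; ring.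
have -> : r1 ^+ 2 + r2 ^+ 2 - 2 * r1 * r2 * cos b = x' ^+ 2 + y' ^+ 2.
  transitivity (r1 ^+ 2 + r2 ^+ 2 * (cos b ^+ 2 + sin b ^+ 2) - 2 * r1 * r2 * cos b);
    first by rewrite hb mulr1.
  by rewrite /x' /y'; ring.
have -> : r0 ^+ 2 + r2 ^+ 2 - 2 * r0 * r2 * cos (a + b) =
   x ^+ 2 + y ^+ 2 + (x' ^+ 2 + y' ^+ 2) + (x * x' + y * y') *+ 2.
  rewrite cosD.
  transitivity (r0 ^+ 2 * (cos a ^+ 2 + sin a ^+ 2) +
    r2 ^+ 2 * (cos b ^+ 2 + sin b ^+ 2) -
    2 * r0 * r2 * (cos a * cos b - sin a * sin b)); first by rewrite ha hb !mulr1.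
  by rewrite /x /y /x' /y'; ring.
apply: sqrtr_le_add; rewrite ?addr_ge0 ?sqr_ge0//.
rewrite -subr_ge0.
have -> : (x ^+ 2 + y ^+ 2) * (x' ^+ 2 + y' ^+ 2) - (x * x' + y * y') ^+ 2 =
  (x * y' - y * x') ^+ 2 by ring.
exact: sqr_ge0.
Qed.

Lemma ler_cone_dist_sq r s L a : 0 <= r -> 0 <= s -> cos_pi L <= cos a ->
  Num.sqrt (r ^+ 2 + s ^+ 2 - 2 * r * s * cos a) <= Num.sqrt (cone_dist_sq r s L).
Proof.
move=> r0 s0 h; rewrite ler_wsqrtr// /cone_dist_sq lerD2l lerN2.
by rewrite ler_wpM2l ?mulr_ge0.
Qed.

Lemma cone_dist_triangle r0 r1 r2 L01 L12 L02 :
  0 <= r0 -> 0 <= r1 -> 0 <= r2 -> 0 <= L01 -> 0 <= L12 -> 0 <= L02 ->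
  L02 <= L01 + L12 ->
  Num.sqrt (cone_dist_sq r0 r2 L02) <=
  Num.sqrt (cone_dist_sq r0 r1 L01) + Num.sqrt (cone_dist_sq r1 r2 L12).
Proof.
move=> r00 r10 r20 L010 L120 L020 L012.
suff [a [b [ha hb hab]]] : exists a b : R,
    [/\ cos_pi L01 <= cos a, cos_pi L12 <= cos b & cos (a + b) <= cos_pi L02].
  apply: (@le_trans _ _
    (Num.sqrt (r0 ^+ 2 + r2 ^+ 2 - 2 * r0 * r2 * cos (a + b)))).
    rewrite ler_wsqrtr// /cone_dist_sq lerD2l lerN2.
    by rewrite ler_wpM2l ?mulr_ge0.
  by apply: (le_trans (planar_triangle _ r1 _ _ _)); apply: lerD;
    exact: ler_cone_dist_sq.
have pi0 : 0 <= pi :> R by exact: pi_ge0.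
have [Lpi|Lpi] := leP (L01 + L12) pi.
  exists L01, L12; split.
  - by rewrite /cos_pi min_l//; lra.
  - by rewrite /cos_pi min_l//; lra.
  - by rewrite -[L01 + L12](min_l Lpi) cos_pi_decr.
exists (Num.min L01 pi), (pi - Num.min L01 pi); split => //.
  apply: ler_cos_0pi.
  - by rewrite subr_ge0 ge_min lexx orbT.
  - by rewrite ge_min lexx orbT.
  - by rewrite le_min; have [|] := leP L01 pi => ?; apply/andP; split; lra.
by rewrite addrC subrK cospi cos_pi_geN1.
Qed.

End euclidean.

(* Nonemptiness is required because measurable types are inhabited. *)
Record convex_body (R : realType) (d : nat) := ConvexBody {
  body_set : set 'rV[R]_d ;
  body_nonempty : body_set !=set0 ;
  body_convex : convex_set body_set ;
  body_compact : compact body_set }.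

Definition body (R : realType) (d : nat) (Om : convex_body R d) : Type :=
  set_type (body_set Om).

Coercion body : convex_body >-> Sortclass.

Section cone.
Context {R : realType} {d : nat} (Om : convex_body R d).
Local Open Scope quotient_scope.

HB.instance Definition _ := Topological.copy Om (set_type (body_set Om)).

Let body_point : Om := SigSub (mem_set (svalP (cid (body_nonempty Om)))).

HB.instance Definition _ := isPointed.Build Om body_point.

HB.instance Definition _ :=
  Measurable.copy Om (g_sigma_algebraType (@open Om)).

Definition body_val (x : Om) : 'rV[R]_d := set_val x.

Lemma body_val_inj : injective body_val.
Proof. exact: val_inj. Qed.

Definition body_dist (x y : Om) : R := enorm (body_val x - body_val y).

Lemma body_dist_ge0 x y : 0 <= body_dist x y.
Proof. exact: enorm_ge0. Qed.

Lemma body_distxx x : body_dist x x = 0.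
Proof. by rewrite /body_dist subrr enorm0. Qed.

Lemma body_distC x y : body_dist x y = body_dist y x.
Proof. by rewrite /body_dist -enormN opprB. Qed.

Lemma body_dist_triangle y x z :
  body_dist x z <= body_dist x y + body_dist y z.
Proof.
rewrite /body_dist -(subrKA (body_val y)).
by rewrite enormD.
Qed.

Lemma body_dist_eq0 x y : body_dist x y = 0 -> x = y.
Proof. by move/enorm_eq0/subr0_eq/body_val_inj. Qed.

(* [x, r] = [y, s] iff r = s and (r = 0 or x = y): all points (x, 0) are
   glued into the tip. *)
Definition cone_eq : rel (Om * {nonneg R}) :=
  fun p q => (p.2 == q.2) && ((p.2%:num == 0) || (p.1 == q.1)).

Lemma cone_eqP p q :
  reflect (p.2 = q.2 /\ (p.2%:num = 0 \/ p.1 = q.1)) (cone_eq p q).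
Proof.
apply: (iffP andP) => -[].
  by move=> /eqP e /orP[/eqP h|/eqP h]; split; [exact: e|left|exact: e|right].
by move=> /eqP e [/eqP h|/eqP h]; split; [exact: e|apply/orP; left|
  exact: e|apply/orP; right].
Qed.

Lemma cone_eq_equiv : equiv_class_of cone_eq.
Proof.
split=> [p|p q|q p r].
- by apply/cone_eqP; split; [reflexivity|right].
- apply/cone_eqP/cone_eqP => -[e1 e2]; (split; first exact: esym).
    by case: e2 => [|<-]; [rewrite e1; left|right].
  by case: e2 => [|<-]; [rewrite e1; left|right].
- move=> /cone_eqP[e1 e2] /cone_eqP[e3 e4]; apply/cone_eqP.
  split; first exact: etrans e1 e3.
  by case: e2 => [h|->]; [left|rewrite -e1 in e4; exact: e4].
Qed.

Canonical cone_equiv := EquivRelPack cone_eq_equiv.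

Definition cone : Type := {eq_quot cone_equiv}.

HB.instance Definition _ := Choice.on cone.
HB.instance Definition _ := EqQuotient.on cone.

Definition cone_pt (x : Om) (r : {nonneg R}) : cone := \pi_cone (x, r).
(* pos is only meaningful away from the tip, where it returns the x of an
   unspecified representative; the notions below do not depend on it. *)
Definition pos (z : cone) : Om := (repr z).1.
Definition rad (z : cone) : R := (repr z).2%:num.

Lemma rad_ge0 z : 0 <= rad z.
Proof. by rewrite /rad; exact: ge0. Qed.

Lemma cone_pt_eq x r y s : cone_pt x r = cone_pt y s ->
  r = s /\ (r%:num = 0 \/ x = y).
Proof.
by move/eqP; rewrite eqquotE => /cone_eqP.
Qed.

Lemma cone_repr z : \pi_cone (repr z) = z.
Proof. exact: reprK. Qed.

Lemma rad_pt x r : rad (cone_pt x r) = r%:num.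
Proof.
have := cone_repr (cone_pt x r).
by case E : (repr _) => [y s] /cone_pt_eq[+ _]; rewrite /rad E => ->.
Qed.

Lemma pos_pt x (r : {nonneg R}) : r%:num != 0 -> pos (cone_pt x r) = x.
Proof.
have := cone_repr (cone_pt x r).
case E : (repr _) => [y s] /cone_pt_eq[]; rewrite /pos E => ->.
by move=> [->|//]; rewrite eqxx.
Qed.

Lemma cone_ext z w : rad z = rad w -> rad z = 0 \/ pos z = pos w -> z = w.
Proof.
move=> rzw h; rewrite -(cone_repr z) -(cone_repr w); apply/eqP.
rewrite eqquotE; apply/cone_eqP; split; last exact: h.
exact: val_inj.
Qed.

Definition cone_dist (z w : cone) : R :=
  Num.sqrt (cone_dist_sq (rad z) (rad w) (body_dist (pos z) (pos w))).

Let cone_distxx z : cone_dist z z = 0.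
Proof.
by rewrite /cone_dist cone_dist_sqE body_distxx cos_pi0 !subrr mulr0 addr0
  expr0n sqrtr0.
Qed.

Let cone_dist_eq0 z w : cone_dist z w = 0 -> z = w.
Proof.
move=> /eqP; rewrite sqrtr_eq0 cone_dist_sqE => h.
have c1 := cos_pi_le1 (body_dist (pos z) (pos w)).
have p0 : 0 <= 2 * (rad z * rad w) * (1 - cos_pi (body_dist (pos z) (pos w))).
  by rewrite mulr_ge0 ?subr_ge0// mulr_ge0// mulr_ge0 ?rad_ge0.
have s0 := sqr_ge0 (rad z - rad w).
have /eqP : (rad z - rad w) ^+ 2 = 0 by lra.
rewrite sqrf_eq0 subr_eq0 => /eqP rzw; apply: cone_ext => //.
have [r0|r0] := eqVneq (rad z) 0; [by left|right].
apply: body_dist_eq0; apply/eqP; rewrite eq_le body_dist_ge0 andbT leNgt.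
apply/negP => /cos_pi_lt1; rewrite -subr_gt0 => k.
have : 0 < 2 * (rad z * rad w) * (1 - cos_pi (body_dist (pos z) (pos w))).
  by rewrite mulr_gt0// mulr_gt0// -rzw mulr_gt0// lt_neqAle eq_sym r0 rad_ge0.
by lra.
Qed.

Let cone_dist_sym z w : cone_dist z w = cone_dist w z.
Proof.
by rewrite /cone_dist body_distC /cone_dist_sq; congr Num.sqrt; ring.
Qed.

Let cone_dist_triangle_ineq w z v :
  cone_dist z v <= cone_dist z w + cone_dist w v.
Proof.
apply: cone_dist_triangle; rewrite ?rad_ge0 ?body_dist_ge0//.
exact: body_dist_triangle.
Qed.

(* The topology of the cone, hence its Borel sets, come from this metric. *)
HB.instance Definition _ := isMetric.Build R cone
  cone_distxx cone_dist_eq0 cone_dist_sym cone_dist_triangle_ineq.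

Definition cone_tip : cone := cone_pt point (NngNum (lexx (0 : R))).

HB.instance Definition _ := isPointed.Build cone cone_tip.

HB.instance Definition _ :=
  Measurable.copy cone (g_sigma_algebraType (@open cone)).

Lemma cone_dist_ptE x r y s : cone_dist (cone_pt x r) (cone_pt y s) =
  Num.sqrt (cone_dist_sq r%:num s%:num (body_dist x y)).
Proof.
rewrite /cone_dist !rad_pt.
have [r0|r0] := eqVneq r%:num 0.
  by rewrite r0 /cone_dist_sq !(mulr0, mul0r).
have [s0|s0] := eqVneq s%:num 0.
  by rewrite s0 /cone_dist_sq !(mulr0, mul0r).
by rewrite !pos_pt.
Qed.

End cone.

Section measurability_criteria.
Context {R : realType}.

Lemma preimage_open_coords (dT : measure_display) (T : measurableType dT)
    (I : finType) (X : topologicalType) (h : I -> X -> R) (g : T -> X) :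
  (forall x (U : set X), nbhs x U ->
    exists2 e : R, 0 < e & forall y, (forall j, `|h j x - h j y| < e) -> U y) ->
  (forall j, measurable_fun setT (h j \o g)) ->
  forall U, open U -> measurable (g @^-1` U).
Proof.
move=> hX hm U oU.
pose Box (p : {ffun I -> rat} * nat) : set X :=
  [set y | forall j, `|h j y - ratr (p.1 j)| < p.2.+1%:R^-1].
have mBox p : measurable (g @^-1` Box p).
  have -> : g @^-1` Box p = \bigcap_(j in [set: I])
      ((h j \o g) @^-1` (ball (ratr (p.1 j) : R) p.2.+1%:R^-1)).
    apply/seteqP; split => t /=.
      by move=> tp j _ /=; rewrite /ball/= distrC; exact: tp.
    by move=> tp j; have := tp j Logic.I; rewrite /= /ball/= distrC.
  apply: fin_bigcap_measurable => // j _.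
  rewrite -[X in measurable X]setTI; apply: hm => //.
  by apply: open_measurable; exact: ball_open.
have -> : g @^-1` U = \bigcup_(p : {ffun I -> rat} * nat)
    (if `[< Box p `<=` U >] then g @^-1` Box p else set0).
  apply/seteqP; split => t /=; last first.
    by move=> [p _]; case: asboolP => // + tp; exact.
  move=> Ut; have [e e0 eU] := hX (g t) U (open_nbhs_nbhs (conj oU Ut)).
  have [n ne] : exists n : nat, n.+1%:R^-1 + n.+1%:R^-1 < e.
    have [n ne] : exists n : nat, n.+1%:R^-1 < e / 2.
      exists (Num.truncn (e / 2)^-1).
      rewrite -[ltRHS]invrK ltf_pV2 ?posrE ?invr_gt0 ?divr_gt0//.
      exact: truncnS_gt.
    by exists n; rewrite [ltRHS](splitr e) ltrD.
  have n0 : 0 < n.+1%:R^-1 :> R by rewrite invr_gt0.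
  have hq j : exists q : rat, `|h j (g t) - ratr q| < n.+1%:R^-1.
    have /rat_in_itvoo[q] : h j (g t) - n.+1%:R^-1 < h j (g t) + n.+1%:R^-1.
      by rewrite ltrBlDr -addrA ltrDl addr_gt0.
    rewrite in_itv/= => /andP[q1 q2]; exists q.
    by rewrite distrC ltr_distl q1 q2.
  pose q := [ffun j => sval (cid (hq j))].
  have qP j : `|h j (g t) - ratr (q j)| < n.+1%:R^-1.
    by rewrite ffunE; case: cid.
  have BU : Box (q, n) `<=` U.
    move=> y /= hy; apply: eU => j.
    rewrite -(subrKA (ratr (q j))) (le_lt_trans (ler_normD _ _))//.
    by rewrite (lt_trans _ ne)// ltrD// distrC.
  by exists (q, n) => //; rewrite asboolT.
apply: countable_bigcupT_measurable => // p; case: ifPn => // _; exact: measurable0.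
Qed.

Lemma measurable_acos (dT : measure_display) (T : measurableType dT)
    (D : set T) (g : T -> R) : measurable D ->
  (forall t, D t -> -1 <= g t <= 1) ->
  measurable_fun D g -> measurable_fun D (acos \o g).
Proof.
move=> mD gD mg.
pose f (x : R) := acos (Num.max (-1) (Num.min 1 x)).
apply: (@eq_measurable_fun _ _ _ _ _ (f \o g)).
  move=> t; rewrite inE => /gD /andP[g1 g2].
  by rewrite /f/= (min_r g2) (max_r g1).
apply: measurableT_comp => //; apply: nonincreasing_measurable => // x y xy.
rewrite /f; set x' := Num.max _ (_ _ x); set y' := Num.max _ (_ _ y).
have xI : -1 <= x' <= 1.
  by rewrite le_max lexx/= ge_max ge_min lexx/= andbT; lra.
have yI : -1 <= y' <= 1.
  by rewrite le_max lexx/= ge_max ge_min lexx/= andbT; lra.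
have xy' : x' <= y'.
  by rewrite ge_max !le_max lexx/= le_min !ge_min lexx xy/= !orbT.
rewrite leNgt; apply/negP => h.
have : cos (acos y') < cos (acos x').
  by rewrite ltr_cos// in_itv/= acos_ge0 ?acos_lepi.
by rewrite !acosK ?in_itv//= ltNge xy'.
Qed.

Lemma measurable_sqrtr (dT : measure_display) (T : measurableType dT)
    (D : set T) (g : T -> R) :
  measurable_fun D g -> measurable_fun D (fun t => Num.sqrt (g t)).
Proof.
move=> mg; rewrite -[X in measurable_fun _ X]/(Num.sqrt \o g).
apply: measurableT_comp => //.
by apply: continuous_measurable_fun; exact: sqrt_continuous.
Qed.

Lemma measurable_cos_pi (dT : measure_display) (T : measurableType dT)
    (D : set T) (g : T -> R) :
  measurable_fun D g -> measurable_fun D (fun t => cos_pi (g t)).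
Proof.
move=> mg; rewrite -[X in measurable_fun _ X]/(cos \o (fun t => Num.min (g t) pi)).
apply: measurableT_comp.
  by apply: continuous_measurable_fun; exact: continuous_cos.
by apply: measurable_minr => //; exact: measurable_cst.
Qed.

Lemma measurable_inv (dT : measure_display) (T : measurableType dT)
    (D : set T) (g : T -> R) :
  measurable_fun D g -> measurable_fun D (fun t => (g t)^-1).
Proof.
move=> mg; rewrite -[X in measurable_fun _ X]/(GRing.inv \o g).
apply: measurableT_comp => //.
have -> : [set: R] = [set 0] `|` ~` [set 0] by rewrite setUv.
apply/measurable_funU => //; first exact: measurableC.
split; first exact: measurable_fun_set1.
apply: open_continuous_measurable_fun.
  apply: closed_openC; apply: accessible_closed_set1.
  exact/hausdorff_accessible/Rhausdorff.
by move=> x; rewrite inE/= => /eqP x0; exact: inv_continuous.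
Qed.

End measurability_criteria.

Section cone_measurability.
Context {R : realType} {d : nat} (Om : convex_body R d).
Local Notation coord i x := (body_val x 0 i).

Lemma body_nbhs_coords (x : Om) (U : set Om) : nbhs x U ->
  exists2 e : R, 0 < e &
    forall y, (forall i, `|coord i x - coord i y| < e) -> U y.
Proof.
rewrite nbhsE => -[V [[W oW WV] Vx] VU].
have Wx : W (body_val x) by rewrite -WV in Vx.
have /nbhs_ballP[e/= e0 eW] := open_nbhs_nbhs (conj oW Wx).
exists e => // y xy; apply: VU; rewrite -WV; apply: eW.
split => // i j; rewrite (ord1 i); exact: xy.
Qed.

Lemma measurable_body_coord (i : 'I_d) :
  measurable_fun setT (fun x : Om => coord i x).
Proof.
apply: (measurability _ (RGenOpens.measurableE R)).
move=> _ [_ [a [b ->] <-]]; rewrite setTI; apply: sub_sigma_algebra.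
exists ((fun v : 'rV[R]_d => v 0 i) @^-1` `]a, b[%classic) => //.
apply: open_comp; last exact: interval_open.
by move=> v _; exact: coord_continuous.
Qed.

Lemma measurable_to_body (dT : measure_display) (T : measurableType dT)
    (g : T -> Om) : (forall i, measurable_fun setT (fun t => coord i (g t))) ->
  measurable_fun setT g.
Proof.
move=> mg; apply: (measurability (@open Om)) => // _ [U oU <-].
rewrite setTI.
apply: (@preimage_open_coords _ _ _ _ _ (fun i x => coord i x)) => //.
exact: body_nbhs_coords.
Qed.

Lemma cone_nbhs_coords (z : cone Om) (U : set (cone Om)) : nbhs z U ->
  exists2 e : R, 0 < e & forall w, `|rad z - rad w| < e ->
    (forall i, `|coord i (pos z) - coord i (pos w)| < e) -> U w.
Proof.
move=> /nbhs_ballP[e/= e0 eU].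
set r := rad z; have r0 : 0 <= r by exact: rad_ge0.
have r10 : 0 < r + 1 by rewrite ltr_wpDl.
pose k := e ^+ 2 / (4 * (r + 1) ^+ 2).
have k0 : 0 < k by rewrite divr_gt0 ?exprn_gt0// mulr_gt0// exprn_gt0.
have [h h0 hk] : exists2 h : R, 0 < h &
    forall L, 0 <= L -> L < h -> 1 - cos_pi L < k.
  have /cvgrPdist_lt/(_ _ k0)/nbhs_ballP[h/= h0 hk] := @continuous_cos R 0.
  exists h => // L L0 Lh.
  have m0 : 0 <= Num.min L pi by rewrite le_min L0 pi_ge0.
  have /hk/= : ball 0 h (Num.min L pi).
    rewrite /ball/= sub0r normrN ger0_norm//.
    by rewrite (le_lt_trans _ Lh)// ge_min lexx.
  by rewrite cos0 => /(le_lt_trans (ler_norm _)).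
pose g := Num.min (Num.min 1 (e / 2)) (h / d.+1%:R).
have g0 : 0 < g by rewrite !lt_min ltr01 !divr_gt0.
have g1 : g <= 1 by rewrite !ge_min lexx.
have ge2 : g <= e / 2 by rewrite !ge_min lexx orbT.
have gh : g * d.+1%:R <= h by rewrite -ler_pdivlMr// ge_min lexx orbT.
exists g => // w rzw xzw; apply: eU.
rewrite ballEmdist/= -[ltRHS]ger0_norm ?(ltW e0)// -sqrtr_sqr.
rewrite /mdist/= /cone_dist ltr_sqrt ?exprn_gt0//.
set L := body_dist _ _; rewrite cone_dist_sqE -/r.
have L0 : 0 <= L by exact: body_dist_ge0.
have Lh : L < h.
  apply: (le_lt_trans (enorm_le_sum _)); apply: lt_le_trans gh.
  rewrite mulr_natr mulrSr.
  apply: (@le_lt_trans _ _ (g *+ d)); last by rewrite ltrDl.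
  rewrite -[X in _ *+ X]card_ord -sumr_const; apply: ler_sum => i _.
  by rewrite !mxE ltW.
have {}hk := hk _ L0 Lh.
have s0 : 0 <= rad w by exact: rad_ge0.
have s1 : rad w <= r + 1.
  by move: rzw; rewrite distrC ltr_distl => /andP[_ ?]; lra.
have c0 : 0 <= 1 - cos_pi L by rewrite subr_ge0 cos_pi_le1.
have h1 : (r - rad w) ^+ 2 <= (e / 2) ^+ 2.
  have e2 : 0 <= e / 2 by rewrite divr_ge0// ltW.
  rewrite -(real_normK (num_real (r - rad w))) ler_pXn2r ?nnegrE//.
  exact: le_trans (ltW rzw) ge2.
have h2 : 2 * (r * rad w) * (1 - cos_pi L) <= 2 * (r + 1) ^+ 2 * k.
  apply: ler_pM => //; first by rewrite !mulr_ge0.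
    rewrite ler_wpM2l// expr2; apply: ler_pM => //.
    by rewrite lerDl.
  exact: ltW.
have h3 : 2 * (r + 1) ^+ 2 * k = e ^+ 2 / 2.
  by rewrite /k; field; rewrite gt_eqF.
apply: (le_lt_trans (lerD h1 h2)); rewrite h3.
have := exprn_gt0 2 e0; rewrite expr_div_n; lra.
Qed.

Lemma cone_open (A : set (cone Om)) :
  (forall z, A z -> exists2 k : R, 0 < k & forall w, mdist z w < k -> A w) ->
  open A.
Proof.
move=> hA; rewrite openE => z /hA[k k0 kA]; apply/nbhs_ballP.
by exists k => //= w; rewrite ballEmdist/=; exact: kA.
Qed.

Lemma measurable_rad : measurable_fun setT (@rad R d Om).
Proof.
apply: (measurability _ (RGenOpens.measurableE R)).
move=> _ [_ [a [b ->] <-]]; rewrite setTI; apply: sub_sigma_algebra.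
apply: cone_open => z zab; have /nbhs_ballP[e/= e0 eab] :=
  open_nbhs_nbhs (conj (@interval_open R (BRight a) (BLeft b) isT isT) zab).
exists e => // w zw.
apply: eab; rewrite /ball/=; apply: le_lt_trans zw.
rewrite -sqrtr_sqr ler_wsqrtr// cone_dist_sqE lerDl.
by rewrite mulr_ge0 ?mulr_ge0 ?rad_ge0// subr_ge0 cos_pi_le1.
Qed.

Lemma cone_ball_coord (z : cone Om) (i : 'I_d) (e : R) :
  0 < rad z -> 0 < e -> exists2 k : R, 0 < k & forall w, mdist z w < k ->
    0 < rad w /\ `|coord i (pos z) - coord i (pos w)| < e.
Proof.
set r := rad z => r0 e0.
pose c := 1 - cos_pi e.
have c0 : 0 < c by rewrite subr_gt0 cos_pi_lt1.
have c2 : c <= 2 by rewrite /c; have := cos_pi_geN1 e; lra.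
exists (r * c / 2); first by rewrite divr_gt0// mulr_gt0.
move=> w zw; rewrite [mdist z w]/(cone_dist z w) in zw.
have k0 : 0 < r * c / 2 by rewrite divr_gt0// mulr_gt0.
have : cone_dist_sq r (rad w) (body_dist (pos z) (pos w)) < (r * c / 2) ^+ 2.
  rewrite -ltr_sqrt ?exprn_gt0// sqrtr_sqr ger0_norm ?ltW//.
rewrite cone_dist_sqE; set L := body_dist _ _ => hL.
have s0 : 0 <= rad w by exact: rad_ge0.
have cL0 : 0 <= 1 - cos_pi L by rewrite subr_ge0 cos_pi_le1.
have p0 : 0 <= 2 * (r * rad w) * (1 - cos_pi L).
  by rewrite mulr_ge0// mulr_ge0// mulr_ge0// ltW.
have c21 : c / 2 <= 1 by lra.
have r0' : 0 <= r by exact: ltW.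
have kr : r * c / 2 <= r by rewrite -mulrA ler_piMr.
have sr : `|r - rad w| < r * c / 2.
  rewrite -(@ltr_pXn2r _ 2) ?nnegrE//; last exact: ltW.
  by rewrite (real_normK (num_real (r - rad w))); lra.
have sp : 0 < rad w.
  by move: sr; rewrite distrC ltr_distl => /andP[+ _]; lra.
split => //; apply: (@le_lt_trans _ _ L).
  have := ler_enorm (body_val (pos z) - body_val (pos w)) i.
  by rewrite !mxE.
rewrite ltNge; apply/negP => eL.
have cc : c <= 1 - cos_pi L by rewrite lerD2l lerN2 cos_pi_decr// ltW.
have hc : 2 * (r * rad w) * c <= 2 * (r * rad w) * (1 - cos_pi L).
  by rewrite ler_wpM2l// mulr_ge0// mulr_ge0// ltW.
have : (r - rad w) ^+ 2 + 2 * (r * rad w) * c < (r * c / 2) ^+ 2 by lra.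
have rs0 : 0 <= r * rad w by rewrite mulr_ge0// ltW.
rewrite ltNge => /negP; apply; rewrite -subr_ge0.
have [c1|c1] := leP 1 c.
  have -> : (r - rad w) ^+ 2 + 2 * (r * rad w) * c - (r * c / 2) ^+ 2 =
    r ^+ 2 * (1 - c / 2) * (1 + c / 2) + 2 * (r * rad w) * (c - 1) +
    rad w ^+ 2 by field.
  by rewrite !addr_ge0 ?sqr_ge0// !mulr_ge0 ?sqr_ge0//; lra.
have -> : (r - rad w) ^+ 2 + 2 * (r * rad w) * c - (r * c / 2) ^+ 2 =
  (rad w - r * (1 - c)) ^+ 2 + r ^+ 2 * (c / 2) * (4 - 5 * (c / 2)) by field.
by rewrite !addr_ge0 ?sqr_ge0// !mulr_ge0 ?sqr_ge0//; lra.
Qed.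

Lemma cone_tip_unique (z : cone Om) : rad z = 0 -> z = cone_tip Om.
Proof. by move=> z0; apply: cone_ext; [rewrite rad_pt|left]. Qed.

Lemma measurable_pos_coord (i : 'I_d) :
  measurable_fun setT (fun z : cone Om => coord i (pos z)).
Proof.
pose D := [set z : cone Om | 0 < rad z].
have mD : measurable D.
  have -> : D = @rad R d Om @^-1` `]0, +oo[%classic.
    by apply/seteqP; split => z; rewrite /D/= in_itv/= andbT.
  by rewrite -[X in measurable X]setTI; apply: measurable_rad.
have -> : [set: cone Om] = D `|` ~` D by rewrite setUv.
apply/measurable_funU => //; first exact: measurableC.
split; last first.
  have -> : ~` D = [set cone_tip Om].
    apply/seteqP; split => z /=.
      move/negP; rewrite -leNgt => z0; apply: cone_tip_unique.
      by apply/le_anti; rewrite z0 rad_ge0.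
    by move=> ->; rewrite /D/= rad_pt ltxx.
  exact: measurable_fun_set1.
apply: (measurability _ (RGenOpens.measurableE R)).
move=> _ [_ [a [b ->] <-]]; apply: sub_sigma_algebra.
apply: cone_open => z [Dz zab]; have /nbhs_ballP[e/= e0 eab] :=
  open_nbhs_nbhs (conj (@interval_open R (BRight a) (BLeft b) isT isT) zab).
have [k k0 kP] := cone_ball_coord i Dz e0.
exists k => // w zw.
by have [w0 wz] := kP _ zw; split => //; exact: eab.
Qed.

Lemma measurable_pos : measurable_fun setT (@pos R d Om).
Proof. by apply: measurable_to_body => i; exact: measurable_pos_coord. Qed.

Lemma measurable_to_cone (dT : measure_display) (T : measurableType dT)
    (g : T -> cone Om) : measurable_fun setT (fun t => rad (g t)) ->
  (forall i, measurable_fun setT (fun t => coord i (pos (g t)))) ->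
  measurable_fun setT g.
Proof.
move=> mr mx; apply: (measurability (@open (cone Om))) => // _ [U oU <-].
rewrite setTI.
pose h (o : option 'I_d) (z : cone Om) : R :=
  if o is Some i then coord i (pos z) else rad z.
apply: (@preimage_open_coords _ _ _ _ _ h) => //; last by case.
move=> z V /cone_nbhs_coords[e e0 eV]; exists e => // w hw.
by apply: eV => [|i]; [exact: (hw None)|exact: (hw (Some i))].
Qed.

End cone_measurability.

Section geodesic_formulas.
Context {R : realType}.

Definition geo_rad (s L r0 r1 : R) : R :=
  Num.sqrt ((1 - s) ^+ 2 * r0 ^+ 2 + s ^+ 2 * r1 ^+ 2 +
            2 * s * (1 - s) * r0 * r1 * cos_pi L).

(* When L = 0 or the radius vanishes the value is irrelevant and set to 0.
   In the case L >= pi the radius vanishes exactly when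
   s * r1 = (1 - s) * r0. *)
Definition geo_rho (s L r0 r1 : R) : R :=
  let r := geo_rad s L r0 r1 in
  if (L == 0) || (r == 0) then 0
  else if L < pi then acos (((1 - s) * r0 + s * r1 * cos L) / r) / L
  else if s * r1 < (1 - s) * r0 then 0 else 1.

Lemma geo_rad_ge0 (s L r0 r1 : R) : 0 <= geo_rad s L r0 r1.
Proof. exact: sqrtr_ge0. Qed.

Lemma geo_arg_bounds (s L r0 r1 : R) : 0 <= s <= 1 -> 0 <= L -> L < pi ->
  0 <= r0 -> 0 <= r1 -> 0 < geo_rad s L r0 r1 ->
  cos L <= ((1 - s) * r0 + s * r1 * cos L) / geo_rad s L r0 r1 <= 1.
Proof.
move=> /andP[s0 s1] L0 Lpi r00 r10 rs0.
rewrite ler_pdivlMr// ler_pdivrMr// mul1r.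
have s10 : 0 <= 1 - s by rewrite subr_ge0.
have cE : cos_pi L = cos L by rewrite /cos_pi min_l// ltW.
set r := geo_rad s L r0 r1 in rs0 *; set c := cos L in cE *.
set a := (1 - s) * r0; set b := s * r1.
have a0 : 0 <= a by exact: mulr_ge0.
have b0 : 0 <= b by exact: mulr_ge0.
have c1 : c <= 1 by exact: cos_le1.
have cN1 : -1 <= c by exact: cos_geN1.
have ab0 : 0 <= a * b by exact: mulr_ge0.
have cc : 0 <= 1 - c ^+ 2 by rewrite -sin2cos2 sqr_ge0.
have rE' : r ^+ 2 = a ^+ 2 + b ^+ 2 + 2 * a * b * c.
  rewrite /r /geo_rad cE.
  have -> : (1 - s) ^+ 2 * r0 ^+ 2 + s ^+ 2 * r1 ^+ 2 +
      2 * s * (1 - s) * r0 * r1 * c =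
    (a - b) ^+ 2 + 2 * (a * b) * (1 + c) by rewrite /a /b; ring.
  rewrite sqr_sqrtr; first by rewrite /a /b; ring.
  by rewrite addr_ge0 ?sqr_ge0// !mulr_ge0//; lra.
have r0' : 0 <= r by exact: ltW.
apply/andP; split.
  have [c0|c0] := leP 0 c.
    have abc0 : 0 <= a + b * c by rewrite addr_ge0 ?mulr_ge0.
    rewrite -(@ler_pXn2r _ 2) ?nnegrE ?mulr_ge0//.
    rewrite exprMn rE' -subr_ge0.
    have -> : (a + b * c) ^+ 2 - c ^+ 2 * (a ^+ 2 + b ^+ 2 + 2 * a * b * c) =
      (1 - c ^+ 2) * (a ^+ 2 + 2 * (a * b) * c) by ring.
    by rewrite mulr_ge0// addr_ge0 ?sqr_ge0// !mulr_ge0.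
  have cr : c * r <= 0 by rewrite mulr_le0_ge0// ltW.
  have [pos_abc|neg_abc] := leP 0 (a + b * c); first exact: le_trans pos_abc.
  have abcN : 0 <= - (a + b * c) by rewrite oppr_ge0 ltW.
  have crN : 0 <= - (c * r) by rewrite oppr_ge0.
  rewrite -lerN2 -(@ler_pXn2r _ 2) ?nnegrE//.
  rewrite !sqrrN exprMn rE' -subr_ge0.
  have -> : c ^+ 2 * (a ^+ 2 + b ^+ 2 + 2 * a * b * c) - (a + b * c) ^+ 2 =
     (1 - c ^+ 2) * (a * (- (a + b * c) + b * (- c))) by ring.
  have bcN : 0 <= b * - c by rewrite mulr_ge0// oppr_ge0 ltW.
  by rewrite mulr_ge0// mulr_ge0// addr_ge0.
have [pos_abc|neg_abc] := leP 0 (a + b * c);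
  last by rewrite (le_trans (ltW neg_abc)).
rewrite -(@ler_pXn2r _ 2) ?nnegrE// rE' -subr_ge0.
have -> : a ^+ 2 + b ^+ 2 + 2 * a * b * c - (a + b * c) ^+ 2 =
  b ^+ 2 * (1 - c ^+ 2) by ring.
by rewrite mulr_ge0 ?sqr_ge0.
Qed.

Lemma geo_rho_itv (s L r0 r1 : R) : 0 <= s <= 1 -> 0 <= L -> 0 <= r0 -> 0 <= r1 ->
  0 <= geo_rho s L r0 r1 <= 1.
Proof.
move=> s01 L0 r00 r10; rewrite /geo_rho.
case: ifPn => [_|]; first by rewrite lexx ler01.
rewrite negb_or => /andP[L_neq0 r_neq0].
case: ifPn => [Lpi|_]; last by case: ifPn => _; rewrite ?lexx ?ler01.
have Lgt0 : 0 < L by rewrite lt_neqAle eq_sym L_neq0.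
have rgt0 : 0 < geo_rad s L r0 r1 by rewrite lt_neqAle eq_sym r_neq0 geo_rad_ge0.
have /andP[] := geo_arg_bounds s01 L0 Lpi r00 r10 rgt0.
set u := _ / geo_rad _ _ _ _ => u1 u2.
have uI : -1 <= u <= 1 by rewrite u2 (le_trans (cos_geN1 L)).
rewrite divr_ge0 ?acos_ge0//= ler_pdivrMr// mul1r leNgt; apply/negP => h.
have : cos (acos u) < cos L.
  by rewrite ltr_cos// in_itv/= ?L0 ?(ltW Lpi)// acos_ge0// acos_lepi.
by rewrite acosK ?in_itv//= ltNge u1.
Qed.

End geodesic_formulas.

Section geodesic.
Context {R : realType} {d : nat} (Om : convex_body R d).
Implicit Types (s : {i01 R}) (p q : (Om * {nonneg R})%type).

Let i01_itv s : 0 <= s%:num <= 1.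
Proof. by apply/andP. Qed.

Definition geo_pos_val s p q : 'rV[R]_d :=
  let rho := geo_rho s%:num (body_dist p.1 q.1) p.2%:num q.2%:num in
  (1 - rho) *: body_val p.1 + rho *: body_val q.1.

Lemma geo_pos_in s p q : geo_pos_val s p q \in body_set Om.
Proof.
rewrite /geo_pos_val; set rho := geo_rho _ _ _ _.
have /andP[r0 r1] : 0 <= rho <= 1.
  by apply: geo_rho_itv; rewrite ?body_dist_ge0 ?i01_itv//; exact: ge0.
have := @body_convex _ _ Om (body_val q.1) (body_val p.1) (Itv01 r0 r1).
by rewrite addrC; apply; exact: valP.
Qed.

Definition geo_pos s p q : Om := SigSub (geo_pos_in s p q).

Definition geo_pt s p q : cone Om := cone_pt (geo_pos s p q)
  (NngNum (geo_rad_ge0 s%:num (body_dist p.1 q.1) p.2%:num q.2%:num)).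

Definition geod s (z0 z1 : cone Om) : cone Om := geo_pt s (repr z0) (repr z1).

Lemma geo_pt_tipl s x q (r r' : {nonneg R}) : r%:num = 0 ->
  r'%:num = s%:num * q.2%:num -> geo_pt s (x, r) q = cone_pt q.1 r'.
Proof.
move=> r0 rE'; have r10 : 0 <= q.2%:num by exact: ge0.
have /andP[s0 s1] := i01_itv s.
set L := body_dist x q.1.
have rE : geo_rad s%:num L 0 q.2%:num = s%:num * q.2%:num.
  rewrite /geo_rad expr0n/= !(mulr0,mul0r) add0r addr0 -exprMn sqrtr_sqr.
  by rewrite ger0_norm ?mulr_ge0.
apply: cone_ext; first by rewrite !rad_pt /= r0 rE.
have [sr0|sr0] := eqVneq (s%:num * q.2%:num) 0.
  by left; rewrite rad_pt/= r0 rE.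
right; rewrite !pos_pt ?rE'//=; last by rewrite r0 rE.
apply: body_val_inj; rewrite [LHS]/(geo_pos_val _ _ _) /geo_pos_val/= -/L r0.
rewrite /geo_rho rE (negbTE sr0) orbF.
have [L0|L0] := eqVneq L 0.
  by rewrite subr0 scale1r scale0r addr0 (body_dist_eq0 L0).
suff -> : (if L < pi then
    acos (((1 - s%:num) * 0 + s%:num * q.2%:num * cos L) /
           (s%:num * q.2%:num)) / L
  else if s%:num * q.2%:num < (1 - s%:num) * 0 then 0 else 1) = 1.
  by rewrite subrr scale0r scale1r add0r.
rewrite mulr0 add0r; case: ifPn => Lpi; last first.
  by rewrite ltNge mulr_ge0.
rewrite mulrAC divff// mul1r cosK ?divff//.
by rewrite in_itv/= body_dist_ge0 ltW.
Qed.

Lemma geo_pt_tipr s p x (r r' : {nonneg R}) : r%:num = 0 ->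
  r'%:num = (1 - s%:num) * p.2%:num -> geo_pt s p (x, r) = cone_pt p.1 r'.
Proof.
move=> r0 rE'; have r10 : 0 <= p.2%:num by exact: ge0.
have /andP[s0 s1] := i01_itv s.
have s10 : 0 <= 1 - s%:num by rewrite subr_ge0.
set L := body_dist p.1 x.
have rE : geo_rad s%:num L p.2%:num 0 = (1 - s%:num) * p.2%:num.
  rewrite /geo_rad expr0n/= !(mulr0,mul0r) !addr0 -exprMn sqrtr_sqr.
  by rewrite ger0_norm ?mulr_ge0.
apply: cone_ext; first by rewrite !rad_pt /= r0 rE.
have [sr0|sr0] := eqVneq ((1 - s%:num) * p.2%:num) 0.
  by left; rewrite rad_pt/= r0 rE.
right; rewrite !pos_pt ?rE'//=; last by rewrite r0 rE.
apply: body_val_inj; rewrite [LHS]/(geo_pos_val _ _ _) /geo_pos_val/= -/L r0.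
suff -> : geo_rho s%:num L p.2%:num 0 = 0.
  by rewrite subr0 scale1r scale0r addr0.
rewrite /geo_rho rE (negbTE sr0) orbF.
have [//|L0] := eqVneq L 0.
rewrite mulr0 mul0r addr0 divff// acos1 mul0r.
case: ifP => // _; case: ifPn => //.
by rewrite lt_neqAle eq_sym sr0 mulr_ge0.
Qed.

(* geod is independent of the representatives. *)
Lemma geod_ptE s x0 r0 x1 r1 :
  geod s (cone_pt x0 r0) (cone_pt x1 r1) = geo_pt s (x0, r0) (x1, r1).
Proof.
have /andP[s0 s1] := i01_itv s.
have r0_ge0 : 0 <= r0%:num by exact: ge0.
have r1_ge0 : 0 <= r1%:num by exact: ge0.
have s10 : 0 <= 1 - s%:num by rewrite subr_ge0.
pose a : {nonneg R} := NngNum (mulr_ge0 s0 r1_ge0).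
pose b : {nonneg R} := NngNum (mulr_ge0 s10 r0_ge0).
rewrite /geod.
have := cone_repr (cone_pt x0 r0); case: (repr _) => x0' r0'.
move=> /cone_pt_eq[-> h0].
have := cone_repr (cone_pt x1 r1); case: (repr _) => x1' r1'.
move=> /cone_pt_eq[-> h1].
have [r00|r00] := eqVneq r0%:num 0.
  rewrite (@geo_pt_tipl s x0 (x1, r1) r0 a r00 erefl).
  rewrite (@geo_pt_tipl s x0' (x1', r1) r0 a r00 erefl).
  case: h1 => [h1|->//]; apply: cone_ext; first by rewrite !rad_pt.
  by left; rewrite rad_pt/= h1 mulr0.
case: h0 => [h0|->]; first by rewrite h0 eqxx in r00.
case: h1 => [h1|->//].
by rewrite !(@geo_pt_tipr s (x0, r0) _ r1 b h1 erefl).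
Qed.

End geodesic.

Section geodesic_measurability.
Context {R : realType} {d : nat} (Om : convex_body R d) (s : {i01 R}).
Local Notation C := (cone Om).
Local Notation coord i x := (body_val x 0 i).

Let rad1 (z : C * C) := rad z.1.
Let rad2 (z : C * C) := rad z.2.
Let dist12 (z : C * C) := body_dist (pos z.1) (pos z.2).

Let m_coord1 i : measurable_fun setT (fun z : C * C => coord i (pos z.1)).
Proof.
exact: (measurableT_comp (@measurable_pos_coord R d Om i) measurable_fst).
Qed.

Let m_coord2 i : measurable_fun setT (fun z : C * C => coord i (pos z.2)).
Proof.
exact: (measurableT_comp (@measurable_pos_coord R d Om i) measurable_snd).
Qed.

Let m_rad1 : measurable_fun setT rad1.
Proof. exact: (measurableT_comp (@measurable_rad R d Om) measurable_fst). Qed.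

Let m_rad2 : measurable_fun setT rad2.
Proof. exact: (measurableT_comp (@measurable_rad R d Om) measurable_snd). Qed.

Let m_dist12 : measurable_fun setT dist12.
Proof.
apply: measurable_sqrtr; apply: measurable_sum => i.
apply: measurable_funX.
rewrite [X in measurable_fun _ X](_ : _ =
  (fun z : C * C => coord i (pos z.1) - coord i (pos z.2))).
  exact: measurable_funB.
by apply/funext => z; rewrite !mxE.
Qed.

Let rs (z : C * C) := geo_rad s%:num (dist12 z) (rad1 z) (rad2 z).

Let m_rs : measurable_fun setT rs.
Proof.
apply: measurable_sqrtr; apply: measurable_funD; first apply: measurable_funD.
- apply: measurable_funM; [exact: measurable_cst|exact: measurable_funX].
- apply: measurable_funM; [exact: measurable_cst|exact: measurable_funX].
- apply: measurable_funM; last exact: measurable_cos_pi.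
  apply: measurable_funM; last by [].
  by apply: measurable_funM; [exact: measurable_cst|].
Qed.

Let arg (z : C * C) :=
  ((1 - s%:num) * rad1 z + s%:num * rad2 z * cos (dist12 z)) / rs z.

Let m_arg : measurable_fun setT arg.
Proof.
apply: measurable_funM; last exact: measurable_inv.
apply: measurable_funD.
  by apply: measurable_funM; [exact: measurable_cst|].
apply: measurable_funM.
  by apply: measurable_funM; [exact: measurable_cst|].
apply: measurableT_comp; last exact: m_dist12.
by apply: continuous_measurable_fun; exact: continuous_cos.
Qed.

Let clamp (u : R) := Num.max (-1) (Num.min 1 u).

Let rho (z : C * C) := geo_rho s%:num (dist12 z) (rad1 z) (rad2 z).

Let m_rho : measurable_fun setT rho.
Proof.
have -> : rho = fun z => if (dist12 z == 0) || (rs z == 0) then 0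
  else if dist12 z < pi then acos (clamp (arg z)) / dist12 z
  else if s%:num * rad2 z < (1 - s%:num) * rad1 z then 0 else 1.
  apply/funext => z; rewrite /rho /geo_rho -/(rs z).
  case: ifPn => //; rewrite negb_or => /andP[L0 r0].
  case: ifPn => // Lpi; rewrite -/(arg z) /clamp.
  have s01 : 0 <= s%:num <= 1 by apply/andP.
  have rgt0 : 0 < rs z by rewrite lt_neqAle eq_sym r0 geo_rad_ge0.
  have /andP[a1 a2] := geo_arg_bounds s01 (body_dist_ge0 _ _) Lpi
    (rad_ge0 _) (rad_ge0 _) rgt0.
  by rewrite (min_r a2) max_r// (le_trans (cos_geN1 (dist12 z))).
apply: measurable_fun_ifT.
- by apply: measurable_or; apply: measurable_fun_eqr => //; exact: measurable_cst.
- exact: measurable_cst.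
apply: measurable_fun_ifT.
- by apply: measurable_fun_ltr => //; exact: measurable_cst.
- apply: measurable_funM; last exact: measurable_inv.
  apply: (@measurable_acos _ _ _ _ (clamp \o arg)) => //.
    move=> z _ /=; rewrite /clamp le_max lexx/= ge_max ge_min lexx/= andbT.
    lra.
  apply: measurable_maxr; first exact: measurable_cst.
  by apply: measurable_minr; first exact: measurable_cst.
apply: measurable_fun_ifT; try exact: measurable_cst.
by apply: measurable_fun_ltr; apply: measurable_funM => //;
  exact: measurable_cst.
Qed.

Lemma measurable_geod :
  measurable_fun setT (fun z : C * C => geod s z.1 z.2).
Proof.
apply: measurable_to_cone => [|i].
  rewrite [X in measurable_fun _ X](_ : _ = rs) //.
  by apply/funext => z; rewrite /geod /geo_pt rad_pt.
pose x0 : R := coord i (pos (cone_tip Om)).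
rewrite [X in measurable_fun _ X](_ : _ = fun z => if rs z == 0 then x0 else
   (1 - rho z) * coord i (pos z.1) + rho z * coord i (pos z.2)).
  apply: measurable_fun_ifT.
  - by apply: measurable_fun_eqr => //; exact: measurable_cst.
  - exact: measurable_cst.
  - apply: measurable_funD; apply: measurable_funM => //.
    by apply: measurable_funB; [exact: measurable_cst|].
apply/funext => z; case: ifPn => [/eqP r0|r0].
  by rewrite (@cone_tip_unique _ _ _ (geod _ _ _))// /geod /geo_pt rad_pt.
rewrite /geod /geo_pt pos_pt//.
by rewrite [body_val _]/(geo_pos_val _ _ _) /geo_pos_val !mxE.
Qed.

End geodesic_measurability.

Section hellinger_kantorovich.
Local Open Scope ereal_scope.
Context {R : realType} {d : nat} (Om : convex_body R d).
Local Notation C := (cone Om).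

(* The set-function form of the projection; integral_cone_proj gives its
   characterization by integrals of continuous functions. *)
Definition cone_proj (l : {measure set C -> \bar R}) (A : set Om) : \bar R :=
  \int[l]_(z in @pos R d Om @^-1` A) (rad z ^+ 2)%:E.

Lemma measurable_rad_sq : measurable_fun setT (fun z : C => (rad z ^+ 2)%:E).
Proof. by apply/measurable_EFinP/measurable_funX; exact: measurable_rad. Qed.

Lemma rad_sq_ge0 (z : C) : 0 <= (rad z ^+ 2)%:E.
Proof. by rewrite lee_fin sqr_ge0. Qed.

Section cone_proj_measure.
Variable l : {measure set C -> \bar R}.

Let cone_proj0 : cone_proj l set0 = 0.
Proof. by rewrite /cone_proj preimage_set0 integral_set0. Qed.

Let cone_proj_ge0 A : 0 <= cone_proj l A.
Proof. by apply: integral_ge0 => z _; exact: rad_sq_ge0. Qed.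

Let cone_proj_sigma_additive : semi_sigma_additive (cone_proj l).
Proof.
move=> F mF tF mUF.
have mpF k : measurable (@pos R d Om @^-1` F k).
  by rewrite -[X in measurable X]setTI; apply: measurable_pos.
rewrite /cone_proj preimage_bigcup ge0_integral_bigcup//.
- by apply: is_cvg_nneseries => n _ _; exact: cone_proj_ge0.
- apply: measurable_funTS; exact: measurable_rad_sq.
- by move=> z _; exact: rad_sq_ge0.
- apply/trivIsetP => /= i j _ _ ij; rewrite -preimage_setI.
  by move/trivIsetP : tF => /(_ _ _ _ _ ij) ->//; rewrite preimage_set0.
Qed.

HB.instance Definition _ := isMeasure.Build _ _ _ (cone_proj l)
  cone_proj0 cone_proj_ge0 cone_proj_sigma_additive.

Import HBNNSimple.

Lemma ge0_integral_cone_proj (f : Om -> \bar R) :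
  measurable_fun setT f -> (forall x, 0 <= f x) ->
  \int[cone_proj l]_x f x = \int[l]_z ((rad z ^+ 2)%:E * f (pos z)).
Proof.
move=> mf f0; pose f_ := nnsfun_approx measurableT mf.
have m_ n : measurable_fun setT
    (fun z : C => (rad z ^+ 2)%:E * (f_ n (pos z))%:E).
  apply: emeasurable_funM; first exact: measurable_rad_sq.
  apply/measurable_EFinP.
  by apply: (measurableT_comp (f := f_ n)) => //; exact: measurable_pos.
transitivity (limn (fun n => \int[cone_proj l]_x (f_ n x)%:E)).
  rewrite -monotone_convergence//.
  - apply: eq_integral => y _; apply/esym/cvg_lim => //.
    by apply: cvg_nnsfun_approx.
  - by move=> n; exact/measurable_EFinP/measurable_funP.
  - by move=> n y _; rewrite lee_fin.
  - by move=> y _ m n mn; rewrite lee_fin; exact/lefP/nd_nnsfun_approx.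
transitivity (limn (fun n => \int[l]_z ((rad z ^+ 2)%:E * (f_ n (pos z))%:E)));
    last first.
  rewrite -monotone_convergence//.
  - apply: eq_integral => z _; apply/cvg_lim => //.
    apply: cvgeZl => //; exact: cvg_nnsfun_approx.
  - by move=> n z _; rewrite mule_ge0 ?rad_sq_ge0// lee_fin.
  - move=> z _ m n mn; rewrite lee_wpmul2l ?rad_sq_ge0// lee_fin.
    exact/lefP/nd_nnsfun_approx.
congr (limn _); apply/funext => n.
have mpf k : measurable (@pos R d Om @^-1` (f_ n @^-1` [set k])).
  by rewrite -[X in measurable X]setTI; apply: measurable_pos.
under eq_integral do rewrite fimfunE -fsumEFin//.
rewrite ge0_integral_fsum//; last 2 first.
- by move=> y; exact/measurable_EFinP/measurable_funM.
- by move=> y x _; rewrite nnfun_muleindic_ge0.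
transitivity (\sum_(k \in range (f_ n))
    \int[l]_z (k%:E * ((rad z ^+ 2)%:E *
       (\1_(@pos R d Om @^-1` (f_ n @^-1` [set k])) z)%:E))).
  apply: eq_fsbigr => k; rewrite inE => -[x _ <-{k}].
  rewrite integralZl_indic_nnsfun// integral_indic// setIT.
  rewrite ge0_integralZl//.
  - congr (_ * _); rewrite /= /cone_proj integral_mkcond.
    by apply: eq_integral => z _; rewrite epatch_indic.
  - apply: emeasurable_funM; first exact: measurable_rad_sq.
    by apply/measurable_EFinP.
  - by move=> z _; rewrite mule_ge0 ?rad_sq_ge0// lee_fin.
  - by rewrite lee_fin.
rewrite -ge0_integral_fsum//.
- apply: eq_integral => z _; rewrite [f_ n (pos z)]fimfunE.
  rewrite -EFinM mulr_fsumr -fsumEFin//; apply: eq_fsbigr => k _.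
  by rewrite -!EFinM mulrCA.
- move=> k; apply: emeasurable_funM; first exact: measurable_cst.
  apply: emeasurable_funM; first exact: measurable_rad_sq.
  by apply/measurable_EFinP.
- move=> k z _; rewrite muleCA mule_ge0 ?rad_sq_ge0// -EFinM.
  exact: (nnfun_muleindic_ge0 (f_ n) k (pos z)).
Qed.

Lemma integral_cone_proj (phi : Om -> R) : continuous phi ->
  \int[cone_proj l]_x (phi x)%:E = \int[l]_z (rad z ^+ 2 * phi (pos z))%:E.
Proof.
move=> cphi.
have mphi : measurable_fun setT (EFin \o phi).
  apply/measurable_EFinP.
  apply: (measurability _ (RGenOpens.measurableE R)).
  move=> _ [_ [a [b ->] <-]]; rewrite setTI; apply: sub_sigma_algebra.
  by apply: open_comp; [move=> x _; exact: cphi|exact: interval_open].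
rewrite integralE [RHS]integralE; congr (_ - _).
  rewrite ge0_integral_cone_proj//; last exact: measurable_funepos.
  apply: eq_integral => z _.
  by rewrite !funeposE/= -!EFin_max -EFinM maxr_pMr ?sqr_ge0// mulr0.
rewrite ge0_integral_cone_proj//; last exact: measurable_funeneg.
apply: eq_integral => z _.
by rewrite !funenegE/= -!EFin_max -EFinM maxr_pMr ?sqr_ge0// mulr0 mulrN.
Qed.

End cone_proj_measure.

Section interpolation.
Variables (s : {i01 R}) (g : {measure set (C * C) -> \bar R}).

Definition interp : set C -> \bar R :=
  pushforward g (fun z : C * C => geod s z.1 z.2).

Let interp0 : interp set0 = 0.
Proof. by rewrite /interp /pushforward preimage_set0 measure0. Qed.

Let interp_ge0 A : 0 <= interp A.
Proof. by rewrite /interp /pushforward; exact: measure_ge0. Qed.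

Let interp_sigma_additive : semi_sigma_additive interp.
Proof.
move=> F mF tF mUF; rewrite /interp /pushforward preimage_bigcup.
have mg := @measurable_geod R d Om s.
apply: measure_semi_sigma_additive.
- by move=> n; rewrite -[X in measurable X]setTI; exact: mg.
- apply/trivIsetP => /= i j _ _ ij; rewrite -preimage_setI.
  by move/trivIsetP : tF => /(_ _ _ _ _ ij) ->//; rewrite preimage_set0.
- by rewrite -preimage_bigcup -[X in measurable X]setTI; exact: mg.
Qed.

HB.instance Definition _ := isMeasure.Build _ _ _ interp
  interp0 interp_ge0 interp_sigma_additive.

End interpolation.

Definition moment2 (l : {measure set C -> \bar R}) : Prop :=
  \int[l]_z (rad z ^+ 2)%:E < +oo.

Definition moment2_prod (g : {measure set (C * C) -> \bar R}) : Prop :=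
  \int[g]_z (rad z.1 ^+ 2 + rad z.2 ^+ 2)%:E < +oo.

Definition coupling (l0 l1 : {measure set C -> \bar R})
    (g : {measure set (C * C) -> \bar R}) : Prop :=
  forall A : set C, measurable A ->
    pushforward g fst A = l0 A /\ pushforward g snd A = l1 A.

Definition transport_cost (g : {measure set (C * C) -> \bar R}) : \bar R :=
  \int[g]_z (cone_dist z.1 z.2 ^+ 2)%:E.

(* Without couplings (different masses) the infimum, hence the square root,
   is +oo. *)
Definition cone_wasserstein (l0 l1 : {measure set C -> \bar R}) : \bar R :=
  sqrte (ereal_inf [set transport_cost g | g in coupling l0 l1]).

Definition optimal_plan (l0 l1 : {measure set C -> \bar R})
    (g : {measure set (C * C) -> \bar R}) : Prop :=
  coupling l0 l1 g /\
  forall g', coupling l0 l1 g' -> transport_cost g <= transport_cost g'.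

Definition is_lift (mu : {measure set Om -> \bar R})
    (l : {finite_measure set C -> \bar R}) : Prop :=
  moment2 l /\ forall A, measurable A -> cone_proj l A = mu A.

Definition HK (mu0 mu1 : {measure set Om -> \bar R}) : \bar R :=
  ereal_inf [set w | exists l0 l1 : {finite_measure set C -> \bar R},
    [/\ is_lift mu0 l0, is_lift mu1 l1 & w = cone_wasserstein l0 l1]].

Definition optimal_lifts (mu0 mu1 : {measure set Om -> \bar R})
    (l0 l1 : {finite_measure set C -> \bar R}) : Prop :=
  [/\ is_lift mu0 l0, is_lift mu1 l1 &
      forall l0' l1', is_lift mu0 l0' -> is_lift mu1 l1' ->
        cone_wasserstein l0 l1 <= cone_wasserstein l0' l1'].

End hellinger_kantorovich.

(* Main.v *)
(* The upper bound pushes gamma forward by (Z_s, Z_t), since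
   d(Z_s, Z_t) = |s - t| d(z0, z1): for |x0 - x1| < pi the geodesic is a planar
   segment in polar coordinates, otherwise it is a path through the tip.  The
   lower bound follows from the triangle inequality of HK along
   mu0, mu(s), mu(t), mu1.

   For the triangle inequality, two plans g01 and g12 have to be glued along
   mu1.  Partition Om into finitely many small cells A_j of mu1-mass m_j and
   send ((z0, z1), (z1', z2)), distributed as
   sum_j m_j^-1 g01|(x1 in A_j) x g12|(x1' in A_j), to (r1' z0, r1 z2), where
   r1 and r1' are the radii of z1 and z1'.  The rescaling makes the projections
   of this plan exactly mu0 and mu2, whatever the two lifts of mu1 were, and
   the points r1' z1 and r1 z1' have equal radii and nearby positions. *)

Require Import Defs.
From mathcomp Require Import all_boot all_order all_algebra.
From mathcomp Require Import all_classical all_reals all_analysis.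
From mathcomp Require Import measurable_realfun.
From mathcomp Require Import ring lra.

Set Implicit Arguments.
Unset Strict Implicit.
Unset Printing Implicit Defensive.

Import Order.TTheory GRing.Theory Num.Theory.
Import numFieldNormedType.Exports.
Import Defs.

Local Open Scope classical_set_scope.
Local Open Scope ring_scope.

(** * Finite measures *)

Section finite_measures.
Local Open Scope ereal_scope.
Context {d : measure_display} {T : measurableType d} {R : realType}.

(** Restriction to the full set carries a finite-measure structure, so a bound on the total mass is
    enough to bundle [m]. *)
Lemma finite_measure_of (m : {measure set T -> \bar R}) : m setT < +oo ->
  exists m' : {finite_measure set T -> \bar R}, forall A, m' A = m A.
Proof.
move=> moo; exists (mfrestr (measurableT : measurable [set: T]) moo) => A.
by rewrite /= /mfrestr /mrestr setIT.
Qed.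

Lemma integral_mrestr (m : {measure set T -> \bar R}) (D : set T)
    (mD : measurable D) (f : T -> \bar R) :
  measurable_fun setT f -> (forall x, 0 <= f x) ->
  \int[mrestr m mD]_x f x = \int[m]_(x in D) f x.
Proof.
move=> mf f0; rewrite -[in LHS](setUv D) ge0_integral_setU//; last 3 first.
- exact: measurableC.
- by rewrite setUv.
- by apply/disj_setPS; rewrite setICr.
rewrite [X in _ + X]null_set_integral ?adde0//; last 3 first.
- exact: measurableC.
- exact: measurable_funTS.
- by rewrite /= /mrestr setICl measure0.
apply: eq_measure_integral => A mA AD.
by rewrite /= /mrestr setIidl.
Qed.

(** The gluing measure is assembled from such weighted sums of restrictions, and later only its
    integrals of nonnegative functions matter. *)
Lemma exists_measure_sum (I : Type) (s : seq I) (c : I -> {nonneg R})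
    (D : I -> set T) (m : I -> {finite_measure set T -> \bar R}) :
  (forall i, measurable (D i)) ->
  exists m' : {finite_measure set T -> \bar R},
    forall f : T -> \bar R, measurable_fun setT f -> (forall x, 0 <= f x) ->
      \int[m']_x f x =
      \sum_(i <- s) (c i)%:num%:E * \int[m i]_(x in D i) f x.
Proof.
move=> mD; elim: s => [|i s [m1 m1E]].
  (* Restricting to the empty set turns every integral into one over [set0]. *)
  exists (mrestr (mzero : {finite_measure set T -> \bar R}) measurable0).
  move=> f mf f0.
  by rewrite big_nil integral_mrestr// integral_set0.
pose m2 := mscale (c i) (mrestr (m i) (mD i)).
have [|m' m'E] := @finite_measure_of (measure_add m1 m2).
  rewrite [X in X < _](measure_addE m1 m2 setT); apply: lte_add_pinfty.
    by rewrite -ge0_fin_numE//; exact: fin_num_measure.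
  by rewrite -ge0_fin_numE//; exact: fin_num_measure.
exists m' => f mf f0.
rewrite (eq_measure_integral (measure_add m1 m2)); last by move=> *; exact: m'E.
rewrite ge0_integral_measure_add// m1E// big_cons addeC; congr (_ + _).
by rewrite ge0_integral_mscale// integral_mrestr.
Qed.

End finite_measures.

Section image_and_product.
Local Open Scope ereal_scope.
Context {d1 d2 : measure_display} {T1 : measurableType d1}
  {T2 : measurableType d2} {R : realType}.

Lemma exists_image_measure (m : {finite_measure set T1 -> \bar R})
    (f : T1 -> T2) : measurable_fun setT f ->
  exists m' : {finite_measure set T2 -> \bar R},
    (forall A, m' A = m (f @^-1` A)) /\
    forall h : T2 -> \bar R, measurable_fun setT h -> (forall x, 0 <= h x) ->
      \int[m']_x h x = \int[m]_x h (f x).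
Proof.
move=> mf.
pose p := measure_function_pushforward__canonical__measure_function_Measure m mf.
have [|m' m'E] := @finite_measure_of _ _ _ p.
  by rewrite /p/= /pushforward preimage_setT -ge0_fin_numE// fin_num_measure.
exists m'; split=> // h mh h0.
rewrite (eq_measure_integral p); last by move=> *; exact: m'E.
by rewrite (ge0_integral_pushforward mf).
Qed.

Lemma exists_product_measure (m1 : {finite_measure set T1 -> \bar R})
    (m2 : {finite_measure set T2 -> \bar R}) :
  exists m' : {finite_measure set (T1 * T2)%type -> \bar R},
    forall f : (T1 * T2)%type ->  \bar R, measurable_fun setT f ->
      (forall x, 0 <= f x) ->
      \int[m']_z f z = \int[m1]_x \int[m2]_y f (x, y).
Proof.
have [|m' m'E] := @finite_measure_of _ _ _ (m1 \x m2).
  rewrite -setXTT [X in X < _](product_measure1E m1 m2)//.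
  by rewrite lte_mul_pinfty// ?fin_num_measure// -ge0_fin_numE// fin_num_measure.
exists m' => f mf f0.
rewrite (eq_measure_integral (m1 \x m2)); last by move=> *; exact: m'E.
by rewrite fubini_tonelli1.
Qed.

End image_and_product.

(** * Geodesics of the cone *)

Section planar.
Context {R : realType}.
Implicit Types s t L r : R.

(** The radicand is a square plus a nonnegative multiple of [1 + cos_pi L], so the square root can
    be undone. *)
Lemma geo_rad_sqr s L r0 r1 : 0 <= s <= 1 -> 0 <= r0 -> 0 <= r1 ->
  geo_rad s L r0 r1 ^+ 2 = (1 - s) ^+ 2 * r0 ^+ 2 + s ^+ 2 * r1 ^+ 2 +
    2 * s * (1 - s) * r0 * r1 * cos_pi L.
Proof.
move=> /andP[s0 s1] r00 r10; rewrite sqr_sqrtr//.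
have c0 : 0 <= 1 + cos_pi L by have := cos_pi_geN1 L; lra.
have s10 : 0 <= 1 - s by rewrite subr_ge0.
have -> : (1 - s) ^+ 2 * r0 ^+ 2 + s ^+ 2 * r1 ^+ 2 +
    2 * s * (1 - s) * r0 * r1 * cos_pi L =
  ((1 - s) * r0 - s * r1) ^+ 2 + 2 * s * (1 - s) * r0 * r1 * (1 + cos_pi L).
  by ring.
by rewrite addr_ge0 ?sqr_ge0// !mulr_ge0.
Qed.

(* For L < pi the geodesic is the image in polar coordinates of the segment
   from (r0, 0) to (r1 cos L, r1 sin L). *)
Lemma geo_polar s L r0 r1 : 0 <= s <= 1 -> 0 <= L < pi -> 0 <= r0 -> 0 <= r1 ->
  geo_rad s L r0 r1 * cos (geo_rho s L r0 r1 * L) =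
    (1 - s) * r0 + s * r1 * cos L /\
  geo_rad s L r0 r1 * sin (geo_rho s L r0 r1 * L) = s * r1 * sin L.
Proof.
move=> s01 /andP[L0 Lpi] r00 r10; have /andP[s0 s1] := s01.
have s10 : 0 <= 1 - s by rewrite subr_ge0.
have R2 := geo_rad_sqr L s01 r00 r10.
have c2 := cos2Dsin2 L.
have cE : cos_pi L = cos L by rewrite /cos_pi min_l// ltW.
have sL0 : 0 <= sin L by rewrite sin_ge0_pi// L0 ltW.
have R2' : geo_rad s L r0 r1 ^+ 2 =
    ((1 - s) * r0 + s * r1 * cos L) ^+ 2 + (s * r1 * sin L) ^+ 2.
  rewrite R2 cE; transitivity ((1 - s) ^+ 2 * r0 ^+ 2 +
    s ^+ 2 * r1 ^+ 2 * (cos L ^+ 2 + sin L ^+ 2) +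
    2 * s * (1 - s) * r0 * r1 * cos L); first by rewrite c2 mulr1.
  by ring.
(* For [L = 0] the default value 0 of [geo_rho] is harmless, since it only enters multiplied by
   [L]. *)
have [L_eq0|L_neq0] := eqVneq L 0.
  rewrite /geo_rho L_eq0 eqxx/= mul0r cos0 sin0 !mulr0 !mulr1; split => //.
  rewrite /geo_rad cos_pi0.
  rewrite (_ : _ + _ = ((1 - s) * r0 + s * r1) ^+ 2); last by ring.
  by rewrite sqrtr_sqr ger0_norm// addr_ge0// mulr_ge0.
(* A vanishing radius forces both Cartesian coordinates to vanish, whatever the default angle. *)
have [R0|R_neq0] := eqVneq (geo_rad s L r0 r1) 0.
  rewrite R0 !mul0r; move: R2'; rewrite R0 expr0n/= => /esym/eqP.
  by rewrite paddr_eq0 ?sqr_ge0// !sqrf_eq0 => /andP[/eqP-> /eqP->].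
have Rgt0 : 0 < geo_rad s L r0 r1 by rewrite lt_neqAle eq_sym R_neq0 geo_rad_ge0.
have /andP[u1 u2] := geo_arg_bounds s01 L0 Lpi r00 r10 Rgt0.
rewrite /geo_rho (negbTE L_neq0) (negbTE R_neq0)/= Lpi divfK//.
set u := _ / _ in u1 u2 *.
have uI : -1 <= u <= 1 by rewrite u2 (le_trans (cos_geN1 L)).
have Ru : geo_rad s L r0 r1 * u = (1 - s) * r0 + s * r1 * cos L.
  by rewrite /u mulrC divfK.
rewrite acosK ?in_itv//= sin_acos//; split => //.
(* With the radius moved under the root, the radicand becomes [(s * r1 * sin L) ^+ 2], and [sin L]
   is nonnegative. *)
rewrite -[X in X * _](ger0_norm (ltW Rgt0)) -sqrtr_sqr -sqrtrM ?sqr_ge0//.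
rewrite mulrBr mulr1 -exprMn Ru R2' addrAC subrr add0r sqrtr_sqr ger0_norm//.
by rewrite !mulr_ge0.
Qed.

Lemma enormZ n k (v : 'rV[R]_n) : enorm (k *: v) = `|k| * enorm v.
Proof.
rewrite /enorm -sqrtr_sqr -sqrtrM ?sqr_ge0// mulr_sumr.
by congr Num.sqrt; apply: eq_bigr => i _; rewrite mxE exprMn.
Qed.

End planar.

(** * Constant speed and endpoints of cone geodesics *)

Section cone_geodesics.
Context {R : realType} {d : nat} (Om : convex_body R d).
Local Notation C := (cone Om).
Implicit Types (s t : {i01 R}) (z w : C).

Let i01_itv s : 0 <= s%:num <= 1.
Proof. by apply/andP. Qed.

Lemma body_dist_geo_pos s t (p q : Om * {nonneg R}) :
  body_dist (geo_pos s p q) (geo_pos t p q) =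
  `|geo_rho s%:num (body_dist p.1 q.1) p.2%:num q.2%:num -
    geo_rho t%:num (body_dist p.1 q.1) p.2%:num q.2%:num| * body_dist p.1 q.1.
Proof.
rewrite /body_dist -enormN -enormZ; congr enorm.
rewrite [body_val (geo_pos s p q)]/(geo_pos_val _ _ _).
rewrite [body_val (geo_pos t p q)]/(geo_pos_val _ _ _) /geo_pos_val.
by apply/rowP => i; rewrite !mxE /body_dist; ring.
Qed.

Lemma cone_dist_geod s t z w :
  cone_dist (geod s z w) (geod t z w) = `|s%:num - t%:num| * cone_dist z w.
Proof.
rewrite /geod /geo_pt cone_dist_ptE body_dist_geo_pos/=.
rewrite [in RHS]/cone_dist -[X in _ = X * _]sqrtr_sqr -sqrtrM ?sqr_ge0//.
congr Num.sqrt.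
rewrite /cone_dist_sq !geo_rad_sqr ?i01_itv ?ge0//.
rewrite /rad /pos.
set L := body_dist _ _; set r0 := (repr z).2%:num; set r1 := (repr w).2%:num.
have r00 : 0 <= r0 by exact: (rad_ge0 z).
have r10 : 0 <= r1 by exact: (rad_ge0 w).
have L0 : 0 <= L by exact: body_dist_ge0.
have s01 := i01_itv s; have t01 := i01_itv t.
have [Lpi|Lpi] := ltP L pi.
  have Lpi' : 0 <= L < pi by rewrite L0.
  have [cs ss] := geo_polar s01 Lpi' r00 r10.
  have [ct st] := geo_polar t01 Lpi' r00 r10.
  have /andP[p0 p1] := geo_rho_itv s01 L0 r00 r10.
  have /andP[q0 q1] := geo_rho_itv t01 L0 r00 r10.
  set p := geo_rho s%:num _ _ _ in cs ss p0 p1 *.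
  set q := geo_rho t%:num _ _ _ in ct st q0 q1 *.
  (* Both parameters lie in the unit interval, so the angle stays below pi and [cos_pi] is [cos]. *)
  have -> : cos_pi (`|p - q| * L) = cos (p * L) * cos (q * L) +
      sin (p * L) * sin (q * L).
    rewrite /cos_pi min_l; last first.
      apply: le_trans (ltW Lpi); rewrite ler_piMl// ler_norml; lra.
    rewrite -[in LHS](ger0_norm L0) -normrM cos_norm mulrBl cosB//.
  have -> : 2 * geo_rad s%:num L r0 r1 * geo_rad t%:num L r0 r1 *
      (cos (p * L) * cos (q * L) + sin (p * L) * sin (q * L)) =
    2 * ((geo_rad s%:num L r0 r1 * cos (p * L)) *
         (geo_rad t%:num L r0 r1 * cos (q * L)) +
         (geo_rad s%:num L r0 r1 * sin (p * L)) *
         (geo_rad t%:num L r0 r1 * sin (q * L))) by ring.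
  rewrite cs ss ct st.
  have cE : cos_pi L = cos L by rewrite /cos_pi min_l// ltW.
  have sE : sin L ^+ 2 = 1 - cos L ^+ 2 by rewrite sin2cos2.
  (* The summand with [1 - cos L ^+ 2 - sin L ^+ 2] is zero; adding it makes the first equality a
     polynomial identity. *)
  rewrite cE; transitivity ((s%:num - t%:num) ^+ 2 *
      (r0 ^+ 2 + r1 ^+ 2 - 2 * r0 * r1 * cos L)
      + 2 * s%:num * t%:num * r1 ^+ 2 * (1 - cos L ^+ 2 - sin L ^+ 2)).
    by ring.
  by rewrite sE; ring.
have cE : cos_pi L = -1 by rewrite /cos_pi min_r// cospi.
(* For [L >= pi] the geodesic is a line through the tip with signed coordinate
   [(1 - u) r0 - u r1]. *)
have RE (u : {i01 R}) :
    geo_rad u%:num L r0 r1 = `|(1 - u%:num) * r0 - u%:num * r1|.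
  rewrite -sqrtr_sqr /geo_rad cE; congr Num.sqrt; ring.
have L_neq0 : L != 0 by rewrite gt_eqF// (lt_le_trans (pi_gt0 R)).
rewrite cE.
(* The radii times the cosine give the product of the signed coordinates: equal signs mean the same
   end of the segment and cosine 1, opposite signs mean opposite ends and cosine -1. *)
suff -> : 2 * geo_rad s%:num L r0 r1 * geo_rad t%:num L r0 r1 *
    cos_pi (`|geo_rho s%:num L r0 r1 - geo_rho t%:num L r0 r1| * L) =
  2 * (((1 - s%:num) * r0 - s%:num * r1) * ((1 - t%:num) * r0 - t%:num * r1)).
  by ring.
rewrite /geo_rho (negbTE L_neq0)/= ltNge Lpi/= !RE !normr_eq0.
set ps := (1 - s%:num) * r0 - s%:num * r1.
set pt := (1 - t%:num) * r0 - t%:num * r1.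
have [->|ps0] := eqVneq ps 0; first by rewrite normr0 !(mulr0, mul0r).
have [->|pt0] := eqVneq pt 0; first by rewrite normr0 !(mulr0, mul0r).
rewrite -[s%:num * r1 < _]subr_gt0 -[t%:num * r1 < _]subr_gt0 -/ps -/pt.
case: ltgtP ps0 => // ps0 _; case: ltgtP pt0 => // pt0 _;
  rewrite ?subrr ?subr0 ?sub0r ?normrN ?normr0 ?normr1 ?mul0r ?mul1r
    ?cos_pi0 ?cE ?(gtr0_norm ps0) ?(ltr0_norm ps0) ?(gtr0_norm pt0)
    ?(ltr0_norm pt0); ring.
Qed.

Lemma geod0 s z w : s%:num = 0 -> geod s z w = z.
Proof.
move=> s0; rewrite /geod /geo_pt.
have R0 L r0 r1 : 0 <= r0 -> geo_rad 0 L r0 r1 = r0 :> R.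
  move=> r00; rewrite /geo_rad subr0 expr1n !(mulr0,mul0r) mul1r expr0n/=.
  by rewrite mul0r !addr0 sqrtr_sqr ger0_norm.
apply: cone_ext; first by rewrite rad_pt/= s0 R0 ?ge0.
have [h|r0] := eqVneq (repr z).2%:num 0; [left|right].
  by rewrite rad_pt/= s0 R0 ?ge0.
rewrite pos_pt/=; last by rewrite s0 R0 ?ge0.
apply: body_val_inj.
rewrite [LHS]/(geo_pos_val _ _ _) /geo_pos_val s0.
suff -> : geo_rho 0 (body_dist (repr z).1 (repr w).1) (repr z).2%:num
    (repr w).2%:num = 0 :> R by rewrite subr0 scale1r scale0r addr0.
rewrite /geo_rho R0 ?ge0// (negbTE r0) orbF; case: ifPn => // _.
rewrite subr0 mul1r !mul0r addr0 divff// acos1 mul0r.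
by case: ifPn => // _; rewrite lt_neqAle eq_sym r0 ge0.
Qed.

Lemma geod1 s z w : s%:num = 1 -> geod s z w = w.
Proof.
move=> s1; rewrite /geod /geo_pt.
have R1 L r0 r1 : 0 <= r1 -> geo_rad 1 L r0 r1 = r1 :> R.
  move=> r10; rewrite /geo_rad subrr expr1n !(mulr0,mul0r) mul1r expr0n/=.
  by rewrite mul0r addr0 add0r sqrtr_sqr ger0_norm.
apply: cone_ext; first by rewrite rad_pt/= s1 R1 ?ge0.
have [h|r1] := eqVneq (repr w).2%:num 0; [left|right].
  by rewrite rad_pt/= s1 R1 ?ge0.
rewrite pos_pt/=; last by rewrite s1 R1 ?ge0.
apply: body_val_inj.
rewrite [LHS]/(geo_pos_val _ _ _) /geo_pos_val s1.
set L := body_dist _ _.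
(* Here [geo_rho] is 0 by default instead of 1, but the two positions coincide. *)
have [L0|L0] := eqVneq L 0.
  by rewrite (body_dist_eq0 L0) -scalerDl subrK scale1r.
suff -> : geo_rho 1 L (repr z).2%:num (repr w).2%:num = 1 :> R.
  by rewrite subrr scale0r scale1r add0r.
rewrite /geo_rho R1 ?ge0// (negbTE L0) (negbTE r1)/= subrr mul1r mul0r add0r.
case: ifPn => Lpi; last by rewrite ltNge ge0.
by rewrite mulrAC divff// mul1r cosK ?divff// in_itv/= body_dist_ge0 ltW.
Qed.

End cone_geodesics.

(** * Plans between measures on the body *)

Section cone_scaling.
Context {R : realType} {d : nat} (Om : convex_body R d).
Local Notation C := (cone Om).
Implicit Types (k : {nonneg R}) (z w : C).

Definition cone_scale k z : C :=
  cone_pt (pos z) (NngNum (mulr_ge0 (ge0 k) (rad_ge0 z))).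

Lemma rad_scale k z : rad (cone_scale k z) = k%:num * rad z.
Proof. by rewrite rad_pt. Qed.

Lemma pos_scale k z : k%:num * rad z != 0 -> pos (cone_scale k z) = pos z.
Proof. by move=> kz; rewrite pos_pt. Qed.

(** The squared distance is homogeneous of degree two in the pair of radii; [cone_dist_ptE] also
    covers points scaled to the tip. *)
Lemma cone_dist_scale k z w :
  cone_dist (cone_scale k z) (cone_scale k w) = k%:num * cone_dist z w.
Proof.
rewrite cone_dist_ptE/= /cone_dist -[X in _ = X * _](ger0_norm (ge0 k)).
rewrite -sqrtr_sqr -sqrtrM ?sqr_ge0//; congr Num.sqrt.
by rewrite /cone_dist_sq; ring.
Qed.

Lemma cone_dist_sqr z w :
  cone_dist z w ^+ 2 = cone_dist_sq (rad z) (rad w) (body_dist (pos z) (pos w)).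
Proof. by rewrite sqr_sqrtr// cone_dist_sq_ge0 ?rad_ge0. Qed.

Lemma cone_dist_triangle_ineq w z v :
  cone_dist z v <= cone_dist z w + cone_dist w v.
Proof.
apply: cone_dist_triangle; rewrite ?rad_ge0 ?body_dist_ge0//.
exact: body_dist_triangle.
Qed.

(** The distance is at most the sum of the radii, the worst case being [cos_pi = -1]. This makes the
    cost finite under a second moment bound. *)
Lemma cone_dist_sqr_le z w :
  cone_dist z w ^+ 2 <= 2 * (rad z ^+ 2 + rad w ^+ 2).
Proof.
rewrite cone_dist_sqr /cone_dist_sq.
have := cos_pi_geN1 (body_dist (pos z) (pos w)).
set c := cos_pi _ => c1.
have : 0 <= rad z * rad w * (1 + c).
  by rewrite mulr_ge0 ?mulr_ge0 ?rad_ge0//; lra.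
have := sqr_ge0 (rad z - rad w); nra.
Qed.

End cone_scaling.

Section cone_measurable_functions.
Context {R : realType} {d : nat} (Om : convex_body R d).
Context {dT : measure_display} {T : measurableType dT}.
Local Notation C := (cone Om).
Implicit Types (f g : T -> C).

Lemma measurable_body_dist f g :
  measurable_fun setT f -> measurable_fun setT g ->
  measurable_fun setT (fun t => body_dist (pos (f t)) (pos (g t))).
Proof.
move=> mf mg; apply: measurable_sqrtr; apply: measurable_sum => i.
apply: measurable_funX.
rewrite [X in measurable_fun _ X](_ : _ = (fun t =>
    body_val (pos (f t)) 0 i - body_val (pos (g t)) 0 i)).
  apply: measurable_funB.
  - exact: (measurableT_comp (@measurable_pos_coord R d Om i) mf).
  - exact: (measurableT_comp (@measurable_pos_coord R d Om i) mg).
by apply/funext => z; rewrite !mxE.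
Qed.

Lemma measurable_cone_dist f g :
  measurable_fun setT f -> measurable_fun setT g ->
  measurable_fun setT (fun t => cone_dist (f t) (g t)).
Proof.
move=> mf mg; apply: measurable_sqrtr.
have mrf : measurable_fun setT (fun t => rad (f t)).
  exact: (measurableT_comp (@measurable_rad R d Om) mf).
have mrg : measurable_fun setT (fun t => rad (g t)).
  exact: (measurableT_comp (@measurable_rad R d Om) mg).
apply: measurable_funB; first by apply: measurable_funD; exact: measurable_funX.
apply: measurable_funM; last first.
  by apply: measurable_cos_pi; exact: measurable_body_dist.
apply: measurable_funM => //.
by apply: measurable_funM => //; exact: measurable_cst.
Qed.

Lemma measurable_rad_sqr f : measurable_fun setT f ->
  measurable_fun setT (fun t => (rad (f t) ^+ 2)%:E).
Proof.
move=> mf; apply/measurable_EFinP/measurable_funX.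
exact: (measurableT_comp (@measurable_rad R d Om) mf).
Qed.

Lemma measurable_cone_scale (k : T -> {nonneg R}) f :
  measurable_fun setT (fun t => (k t)%:num) -> measurable_fun setT f ->
  measurable_fun setT (fun t => cone_scale (k t) (f t)).
Proof.
move=> mk mf.
have mr : measurable_fun setT (fun t => (k t)%:num * rad (f t)).
  apply: measurable_funM => //.
  exact: (measurableT_comp (@measurable_rad R d Om) mf).
apply: measurable_to_cone => [|i].
  by under eq_fun do rewrite rad_scale.
(* Where the scaled radius vanishes the point is the tip, at which [pos] has one fixed, though
   unspecified, value. *)
rewrite [X in measurable_fun _ X](_ : _ = fun t =>
    if (k t)%:num * rad (f t) == 0 then body_val (pos (cone_tip Om)) 0 i
    else body_val (pos (f t)) 0 i).
  apply: measurable_fun_ifT.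
  - by apply: measurable_fun_eqr => //; exact: measurable_cst.
  - exact: measurable_cst.
  - exact: (measurableT_comp (@measurable_pos_coord R d Om i) mf).
apply/funext => t; case: ifPn => [/eqP h|h]; last by rewrite pos_scale.
by rewrite (@cone_tip_unique _ _ _ (cone_scale _ _))// rad_scale.
Qed.

End cone_measurable_functions.

(** * Plans with prescribed projections and the value of [HK] *)

Section hk_plans.
Local Open Scope ereal_scope.
Context {R : realType} {d : nat} (Om : convex_body R d).
Local Notation C := (cone Om).

(** The integrand of [cone_proj] as a function on the whole cone, so that it can be composed with
    maps into the cone. *)
Definition rad_sq_on (A : set Om) (z : C) : \bar R :=
  (rad z ^+ 2 * \1_A (pos z))%:E.

Lemma rad_sq_on_ge0 A z : 0 <= rad_sq_on A z.
Proof. by rewrite lee_fin mulr_ge0 ?sqr_ge0. Qed.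

Lemma measurable_rad_sq_on A : measurable A ->
  measurable_fun setT (rad_sq_on A).
Proof.
move=> mA; apply/measurable_EFinP; apply: measurable_funM.
  by apply: measurable_funX; exact: measurable_rad.
exact: (measurableT_comp (measurable_indic mA) (@measurable_pos R d Om)).
Qed.

Lemma rad_sq_onT z : rad_sq_on setT z = (rad z ^+ 2)%:E.
Proof. by rewrite /rad_sq_on indicT mulr1. Qed.

(** This homogeneity trades a weight [k ^+ 2] in an integral for a dilation of the point without
    changing the projection. At the tip, where the position is not controlled, both sides vanish. *)
Lemma rad_sq_on_scale A (k : {nonneg R}) z :
  rad_sq_on A (cone_scale k z) = (k%:num ^+ 2)%:E * rad_sq_on A z.
Proof.
rewrite /rad_sq_on rad_scale -EFinM exprMn.
have [|kz] := eqVneq (k%:num * rad z)%R 0%R; last first.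
  by rewrite pos_scale// [in RHS]mulrA.
by move=> h; rewrite [in RHS]mulrA -exprMn h expr0n/= !mul0r.
Qed.

Lemma cone_projE (l : {measure set C -> \bar R}) A :
  cone_proj l A = \int[l]_z rad_sq_on A z.
Proof.
rewrite /cone_proj integral_mkcond; apply: eq_integral => z _.
by rewrite epatch_indic.
Qed.

(** The images of [g] under [p] and [q] are lifts, with second moments equal to the masses of [mu0]
    and [mu1], and the image under the pair couples them. *)
Lemma HK_le {dT} {T : measurableType dT} (g : {finite_measure set T -> \bar R})
    (p q : T -> C) (mu0 mu1 : {measure set Om -> \bar R}) :
  measurable_fun setT p -> measurable_fun setT q ->
  mu0 setT < +oo -> mu1 setT < +oo ->
  (forall A, measurable A -> \int[g]_t rad_sq_on A (p t) = mu0 A) ->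
  (forall A, measurable A -> \int[g]_t rad_sq_on A (q t) = mu1 A) ->
  HK mu0 mu1 <= sqrte (\int[g]_t (cone_dist (p t) (q t) ^+ 2)%:E).
Proof.
move=> mp mq mu0oo mu1oo h0 h1.
have [l0 [l0E il0]] := exists_image_measure g mp.
have [l1 [l1E il1]] := exists_image_measure g mq.
have mpq : measurable_fun setT (fun t => (p t, q t)) by exact: measurable_fun_pair.
have [g' [g'E ig']] := exists_image_measure g mpq.
have lift (mu : {measure set Om -> \bar R}) (l : {finite_measure set C -> \bar R})
    (f : T -> C) : mu setT < +oo ->
    (forall h, measurable_fun setT h -> (forall x, 0 <= h x) ->
      \int[l]_x h x = \int[g]_x h (f x)) ->
    (forall A, measurable A -> \int[g]_t rad_sq_on A (f t) = mu A) ->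
    is_lift mu l.
  move=> muoo il h.
  have lE A : measurable A -> \int[l]_z rad_sq_on A z = mu A.
    move=> mA; rewrite il ?h//; first exact: measurable_rad_sq_on.
    by move=> z; exact: rad_sq_on_ge0.
  split; last by move=> A mA; rewrite cone_projE lE.
  rewrite /moment2; under eq_integral do rewrite -rad_sq_onT.
  by rewrite lE.
have L0 : is_lift mu0 l0 by exact: (lift mu0 l0 p mu0oo il0 h0).
have L1 : is_lift mu1 l1 by exact: (lift mu1 l1 q mu1oo il1 h1).
apply: (@le_trans _ _ (cone_wasserstein l0 l1)).
  by apply: ereal_inf_lbound; exists l0, l1.
rewrite lee_sqrt; last by apply: integral_ge0 => t _; rewrite lee_fin sqr_ge0.
apply: ereal_inf_lbound; exists g'.
  move=> A mA; split.
    by apply: etrans (esym (l0E A)); exact: g'E.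
  by apply: etrans (esym (l1E A)); exact: g'E.
rewrite /transport_cost ig'//.
  apply/measurable_EFinP; apply: measurable_funX.
  by apply: measurable_cone_dist; [exact: measurable_fst|exact: measurable_snd].
by move=> z; rewrite lee_fin sqr_ge0.
Qed.

Lemma integral_coupling (l0 l1 : {measure set C -> \bar R})
    (g : {measure set (C * C)%type -> \bar R}) (f : C -> \bar R) :
  coupling l0 l1 g -> measurable_fun setT f -> (forall z, 0 <= f z) ->
  \int[g]_z f z.1 = \int[l0]_z f z /\ \int[g]_z f z.2 = \int[l1]_z f z.
Proof.
move=> gc mf f0; split.
  rewrite -(ge0_integral_pushforward (@measurable_fst _ _ C C) g measurableT)//.
  apply: eq_measure_integral => A mA _.
  by have [+ _] := gc _ mA; apply.
rewrite -(ge0_integral_pushforward (@measurable_snd _ _ C C) g measurableT)//.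
apply: eq_measure_integral => A mA _.
by have [_ +] := gc _ mA; apply.
Qed.

(** A counterpart of [HK_le]: the strict bound allows picking lifts and then a coupling from the two
    infima, without existence of minimizers. *)
Lemma HK_lt_plan (mu0 mu1 : {measure set Om -> \bar R}) (a : R) :
  HK mu0 mu1 < a%:E ->
  exists g : {finite_measure set (C * C)%type -> \bar R},
    [/\ forall A, measurable A -> \int[g]_z rad_sq_on A z.1 = mu0 A,
        forall A, measurable A -> \int[g]_z rad_sq_on A z.2 = mu1 A,
        mu0 setT < +oo, mu1 setT < +oo &
        transport_cost g <= (a ^+ 2)%:E].
Proof.
move=> /ereal_inf_lt[_ [l0 [l1 [[m0 L0] [m1 L1] ->]]]].
rewrite /cone_wasserstein; set I := ereal_inf _ => Ia.
have I0 : 0 <= I.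
  apply: le_ereal_inf_tmp => _ [g _ <-].
  by apply: integral_ge0 => z _; rewrite lee_fin sqr_ge0.
(* Squaring is legitimate because [a] exceeds a square root and is therefore nonnegative. *)
have {}Ia : I < (a ^+ 2)%:E.
  have a0 : (0 <= a)%R by rewrite -lee_fin (le_trans _ (ltW Ia))// sqrte_ge0.
  rewrite -(@sqr_sqrte _ I)// EFin_expe; move: Ia (sqrte_ge0 I).
  case: (sqrte I) => [r| |]//; rewrite !lte_fin lee_fin => ra r0.
  by rewrite -!expr2 ltrXn2r.
have [_ [g gc <-] gI] := ereal_inf_lt Ia.
(* A coupling has the mass of its first marginal, which is finite. *)
have [|g' g'E] := @finite_measure_of _ _ _ g.
  have [h _] := gc setT measurableT.
  rewrite -(preimage_setT (@fst C C)) [X in X < _]h.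
  by rewrite -ge0_fin_numE// fin_num_measure.
have gg' f : \int[g']_z f z = \int[g]_z f z.
  by apply: eq_measure_integral => A _ _; exact: g'E.
have pE A : measurable A -> \int[g]_z rad_sq_on A z.1 = mu0 A /\
    \int[g]_z rad_sq_on A z.2 = mu1 A.
  move=> mA.
  have [-> ->] := integral_coupling gc (measurable_rad_sq_on mA) (rad_sq_on_ge0 A).
  by rewrite -!cone_projE L0// L1.
have fin (l : {measure set C -> \bar R}) (mu : {measure set Om -> \bar R}) :
    moment2 l -> (forall A, measurable A -> cone_proj l A = mu A) -> mu setT < +oo.
  by move=> ml lE; rewrite -lE.
exists g'; split.
- by move=> A mA; rewrite gg'; have [] := pE _ mA.
- by move=> A mA; rewrite gg'; have [] := pE _ mA.
- exact: fin m0 L0.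
- exact: fin m1 L1.
- by rewrite /transport_cost gg'; exact: ltW.
Qed.

End hk_plans.

(** * Gluing *)

Section body_partition.
Context {R : realType} {d : nat} (Om : convex_body R d).

(** Compactness gives a finite cover by small balls, [seqDU] makes it disjoint, and continuity of
    [cos] at 0 bounds the squared chord [2 * (1 - cos_pi L)]. *)
Lemma body_partition (e : R) : 0 < e ->
  exists (n : nat) (A : nat -> set Om),
    [/\ forall i, measurable (A i), trivIset setT A,
        \big[setU/set0]_(i < n) A i = setT &
        forall i x y, A i x -> A i y -> 2 * (1 - cos_pi (body_dist x y)) <= e].
Proof.
move=> e0; have e20 : 0 < e / 2 by rewrite divr_gt0.
have [h h0 hk] : exists2 h : R, 0 < h &
    forall L, 0 <= L -> L < h -> 2 * (1 - cos_pi L) <= e.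
  have /cvgrPdist_lt/(_ _ e20)/nbhs_ballP[h/= h0 hk] := @continuous_cos R 0.
  exists h => // L L0 Lh.
  have m0 : 0 <= Num.min L pi by rewrite le_min L0 pi_ge0.
  have /hk/= : ball 0 h (Num.min L pi).
    rewrite /ball/= sub0r normrN ger0_norm//.
    by rewrite (le_lt_trans _ Lh)// ge_min lexx.
  by rewrite cos0 => /(le_lt_trans (ler_norm _)); rewrite /cos_pi; lra.
(* The balls are those of the sup norm: coordinates of two points in one ball differ by at most
   [2 * r], so their Euclidean distance is at most [d * h / (d + 1) < h], also for [d = 0]. *)
pose r := h / d.+1%:R / 2.
have r0 : 0 < r by rewrite !divr_gt0.
have [D _ cD] : finite_subset_cover (body_set Om)
    (fun c : 'rV[R]_d => ball c r) (body_set Om).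
  have : cover_compact (body_set Om).
    by rewrite -compact_cover; exact: body_compact.
  apply=> [c _|x Ox]; first exact: ball_open.
  by exists x => //; exact: ballxx.
pose s : seq 'rV[R]_d := finmap.enum_fset D.
pose F i : set Om := if (i < size s)%N then
  @body_val R d Om @^-1` ball (nth 0 s i) r else set0.
have mF i : measurable (F i).
  rewrite /F; case: ifP => // _; apply: sub_sigma_algebra.
  by exists (ball (nth 0 s i) r) => //; exact: ball_open.
exists (size s), (seqDU F); split.
- exact: seqDU_measurable.
- exact: trivIset_seqDU.
- rewrite -bigsetU_seqDU; apply/seteqP; split=> // x _.
  have [c cs xc] := cD _ (set_valP x).
  rewrite -bigcup_mkord; exists (index c s) => /=; first by rewrite index_mem.
  by rewrite /F index_mem cs nth_index.
- move=> i x y Ax Ay; have := subset_seqDU Ax; have := subset_seqDU Ay.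
  rewrite /F; case: ifP => // _ yc xc; apply: hk; first exact: body_dist_ge0.
  apply: (le_lt_trans (enorm_le_sum _)).
  have dr : r + r = h / d.+1%:R by rewrite /r -splitr.
  have : h / d.+1%:R *+ d < h.
    have hE : h / d.+1%:R *+ d.+1 = h by rewrite -mulr_natr divfK ?pnatr_eq0.
    by rewrite -[X in _ < X]hE ltr_pMn2l ?divr_gt0.
  apply: le_lt_trans.
  rewrite -[X in _ *+ X]card_ord -sumr_const; apply: ler_sum => j _.
  rewrite !mxE -dr.
  have [_ xcj] := xc; have [_ ycj] := yc.
  have {}xcj := xcj 0 j; have {}ycj := ycj 0 j; rewrite /ball/= in xcj ycj.
  rewrite -(subrKA (nth 0 s i 0 j)) (le_trans (ler_normD _ _))//.
  by rewrite lerD ?ltW// distrC.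
Qed.

End body_partition.

(** * Gluing two plans along a finite partition *)

Section gluing.
Local Open Scope ereal_scope.
Context {R : realType} {d : nat} (Om : convex_body R d).
Local Notation C := (cone Om).
Variables (mu : {measure set Om -> \bar R})
  (g01 g12 : {finite_measure set (C * C)%type -> \bar R}).
Hypothesis muoo : mu setT < +oo.
Hypothesis mu01 : forall A, measurable A -> \int[g01]_x rad_sq_on A x.2 = mu A.
Hypothesis mu12 : forall A, measurable A -> \int[g12]_y rad_sq_on A y.1 = mu A.

Section pieces.
Variables (n : nat) (A : nat -> set Om).
Hypotheses (mA : forall i, measurable (A i)) (tA : trivIset setT A)
  (AT : \big[setU/set0]_(i < n) A i = setT).

Let D01 i : set (C * C)%type := [set x | A i (pos x.2)].
Let D12 i : set (C * C)%type := [set y | A i (pos y.1)].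

Let mpos1 : measurable_fun setT (fun z : C * C => pos z.1).
Proof. exact: (measurableT_comp (@measurable_pos R d Om) measurable_fst). Qed.

Let mpos2 : measurable_fun setT (fun z : C * C => pos z.2).
Proof. exact: (measurableT_comp (@measurable_pos R d Om) measurable_snd). Qed.

Let mD01 i : measurable (D01 i).
Proof. by rewrite -[X in measurable X]setTI; exact: mpos2. Qed.

Let mD12 i : measurable (D12 i).
Proof. by rewrite -[X in measurable X]setTI; exact: mpos1. Qed.

Let integral_cells (p : C * C -> Om) (g : {finite_measure set (C * C)%type -> \bar R})
    (f : (C * C)%type -> \bar R) :
  measurable_fun setT p -> measurable_fun setT f -> (forall z, 0 <= f z) ->
  \int[g]_z f z = \sum_(i < n) \int[g]_(z in p @^-1` A i) f z.
Proof.
move=> mp mf f0; pose D (i : 'I_n) := p @^-1` A i.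
have DT : \big[setU/set0]_(i < n) D i = setT.
  rewrite -(bigcup_mkord n (fun i => p @^-1` A i)) -preimage_bigcup bigcup_mkord.
  by rewrite AT preimage_setT.
rewrite -[in LHS]DT ge0_integral_bigsetU//.
- by move=> i; rewrite /D -[X in measurable X]setTI; exact: mp.
- exact: index_enum_uniq.
- apply/trivIsetP => i j _ _ ij; rewrite /D -preimage_setI.
  by move/trivIsetP : tA => /(_ i j I I ij) ->; rewrite preimage_set0.
- by rewrite DT.
Qed.


Let m i : R := fine (mu (A i)).

Let mE i : mu (A i) = (m i)%:E.
Proof.
rewrite fineK// ge0_fin_numE ?measure_ge0//.
by apply: le_lt_trans muoo; apply: le_measure; rewrite ?inE.
Qed.

Let m_ge0 i : (0 <= m i)%R.
Proof. by rewrite fine_ge0 ?measure_ge0. Qed.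

Let mV_ge0 i : (0 <= (m i)^-1)%R.
Proof. by rewrite invr_ge0. Qed.

Let c i : {nonneg R} := NngNum (mV_ge0 i).
Let w i : {nonneg R} := NngNum (ler0n R (m i == 0)%R).

(** The partners of a point in cell [i] have total weight one: the normalized cell of the other plan
    if [m i] is positive, the Dirac mass otherwise. *)
Let cmw i : (c i)%:num%:E * (m i)%:E + (w i)%:num%:E = 1.
Proof.
rewrite -EFinM -EFinD/=; have [->|m0] := eqVneq (m i) 0%R.
  by rewrite mulr0 add0r.
by rewrite mulVf// addr0.
Qed.

Let wm i : (w i)%:num%:E * (m i)%:E = 0.
Proof.
by rewrite -EFinM/=; have [->|_] := eqVneq (m i) 0%R; rewrite ?mulr0// mul0r.
Qed.

(** Radius one makes the weight [rad ^+ 2] of a Dirac partner equal to one. *)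
Let unit_pt : C := cone_pt point (NngNum (ler01 : (0 <= 1 :> R)%R)).

(* On cells with m i = 0 the weight c i is 0^-1 = 0; there the Dirac masses
   supply a partner, whose tip component makes the other plan vanish. *)
Let exists_pieces : exists M : {finite_measure set ((C * C) * (C * C))%type -> \bar R},
  forall F : ((C * C) * (C * C))%type -> \bar R,
    measurable_fun setT F -> (forall t, 0 <= F t) ->
  \int[M]_t F t =
  \sum_(i < n) \int[g01]_(x in D01 i)
    ((c i)%:num%:E * \int[g12]_(y in D12 i) F (x, y) +
     (w i)%:num%:E * F (x, (unit_pt, cone_tip Om))) +
  \sum_(i < n) (w i)%:num%:E *
    \int[g12]_(y in D12 i) F ((cone_tip Om, unit_pt), y).
Proof.
pose dl : {finite_measure set (C * C)%type -> \bar R} := \d_(unit_pt, cone_tip Om).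
pose dr : {finite_measure set (C * C)%type -> \bar R} := \d_(cone_tip Om, unit_pt).
have mBool i (b : bool) : measurable (if b then D12 i else setT).
  by case: b.
have /choice[beta betaE] (i : nat) := exists_measure_sum [:: true; false]
  (fun b => if b then c i else w i) (fun b => if b then g12 else dl) (mBool i).
have [nu nuE] := exists_measure_sum (index_enum 'I_n) (fun i => w i)
  (fun=> g12) (fun i : 'I_n => mD12 i).
have /choice[P PE] (i : nat) :=
  exists_product_measure (mrestr g01 (mD01 i)) (beta i).
have [N NE] := exists_product_measure dr nu.
(* [Some i] stands for the product over cell [i], [None] for the Dirac partners of the second plan
   on all null cells. *)
have [M ME] := exists_measure_sum (None :: map Some (index_enum 'I_n))
  (fun=> NngNum (ler01 : (0 <= 1 :> R)%R)) (fun o => if o is Some i then P i else N)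
  (fun=> measurableT).
exists M => F mF F0; rewrite ME// big_cons big_map mul1e [RHS]addeC.
have F1 x : measurable_fun setT (fun y => F (x, y)).
  by apply: (measurableT_comp mF); exact: pair1_measurable.
congr (_ + _); last first.
  apply: eq_bigr => i _; rewrite mul1e PE// integral_mrestr//; last 2 first.
  - exact: (@measurable_fun_fubini_tonelli_F _ _ _ _ _ (beta i) F).
  - by move=> x; exact: integral_ge0.
  apply: eq_integral => x _; rewrite betaE// !big_cons big_nil adde0/=.
  by rewrite integral_dirac// diracT mul1e.
rewrite NE// integral_dirac//; last first.
  exact: (@measurable_fun_fubini_tonelli_F _ _ _ _ _ nu F).
by rewrite diracT mul1e nuE.
Qed.

Let cell01 i : \int[g01]_(x in D01 i) (rad x.2 ^+ 2)%:E = (m i)%:E.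
Proof.
rewrite -mE -mu01// integral_mkcond; apply: eq_integral => x _.
by rewrite epatch_indic.
Qed.

Let cell12 i : \int[g12]_(y in D12 i) (rad y.1 ^+ 2)%:E = (m i)%:E.
Proof.
rewrite -mE -mu12// integral_mkcond; apply: eq_integral => y _.
by rewrite epatch_indic.
Qed.

Let mrad1 : measurable_fun setT (fun z : C * C => (rad z.1 ^+ 2)%:E).
Proof. exact: (measurable_rad_sqr measurable_fst). Qed.

Let mrad2 : measurable_fun setT (fun z : C * C => (rad z.2 ^+ 2)%:E).
Proof. exact: (measurable_rad_sqr measurable_snd). Qed.

Let total_mass : \sum_(i < n) (m i)%:E = mu setT.
Proof.
rewrite -mu01//; under [RHS]eq_integral do rewrite rad_sq_onT.
rewrite (@integral_cells (fun z => pos z.2))//; last first.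
  by move=> z; rewrite lee_fin sqr_ge0.
by apply: eq_bigr => i _; rewrite -cell01.
Qed.

(** The squared cone distance between [t.1.2] dilated by [rad t.2.1] and [t.2.1] dilated by
    [rad t.1.2], two points of equal radius. *)
Definition gluing_error (t : (C * C) * (C * C)) : R :=
  (2 * (1 - cos_pi (body_dist (pos t.1.2) (pos t.2.1))) *
   (rad t.1.2 ^+ 2 * rad t.2.1 ^+ 2))%R.

(** In the first two claims the squared radius integrates the partner to [m i], which cancels [c i].
    In the third, a positive cell contributes at most [e * c i * m i ^+ 2 = e * m i]. *)
Lemma exists_gluing_pieces (e : R) : (0 < e)%R ->
  (forall i x y, A i x -> A i y -> 2 * (1 - cos_pi (body_dist x y)) <= e)%R ->
  exists M : {finite_measure set ((C * C) * (C * C))%type -> \bar R},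
    [/\ forall f, measurable_fun setT f -> (forall x, 0 <= f x) ->
          \int[M]_t ((rad t.2.1 ^+ 2)%:E * f t.1) = \int[g01]_x f x,
        forall f, measurable_fun setT f -> (forall y, 0 <= f y) ->
          \int[M]_t ((rad t.1.2 ^+ 2)%:E * f t.2) = \int[g12]_y f y &
        \int[M]_t (gluing_error t)%:E <= e%:E * mu setT].
Proof.
move=> e0 Ae; have [M ME] := exists_pieces.
have ru : rad unit_pt = 1%R by rewrite rad_pt.
exists M; split => [f mf f0|f mf f0|].
- rewrite ME; last 2 first.
  + apply: emeasurable_funM.
      exact: (measurableT_comp mrad1 measurable_snd).
    exact: (measurableT_comp mf measurable_fst).
  + by move=> t; rewrite mule_ge0// lee_fin sqr_ge0.
  (* The pieces with a Dirac mass in the first factor carry the weight [w i * m i = 0]. *)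
  rewrite [X in _ + X]big1 ?adde0; last first.
    move=> i _ /=; rewrite ge0_integralZr//.
    + by rewrite cell12 muleA wm mul0e.
    + exact: measurable_funTS.
    + by move=> y _; rewrite lee_fin sqr_ge0.
  rewrite (@integral_cells (fun z => pos z.2))//.
  apply: eq_bigr => i _; apply: eq_integral => x _ /=.
  rewrite ge0_integralZr//; last 2 first.
  + exact: measurable_funTS.
  + by move=> y _; rewrite lee_fin sqr_ge0.
  rewrite cell12 ru expr1n mul1e muleA -ge0_muleDl ?cmw ?mul1e//.
  by rewrite -EFinM lee_fin mulr_ge0.
- rewrite ME; last 2 first.
  + apply: emeasurable_funM.
      exact: (measurableT_comp mrad2 measurable_fst).
    exact: (measurableT_comp mf measurable_snd).
  + by move=> t; rewrite mule_ge0// lee_fin sqr_ge0.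
  rewrite (@integral_cells (fun z => pos z.1))// -big_split.
  apply: eq_bigr => i _.
  change (\int[g01]_(x in D01 i)
      ((c i)%:num%:E * \int[g12]_(y in D12 i) ((rad x.2 ^+ 2)%:E * f y) +
       (w i)%:num%:E * ((rad x.2 ^+ 2)%:E * f (unit_pt, cone_tip Om))) +
    (w i)%:num%:E * \int[g12]_(y in D12 i) ((rad unit_pt ^+ 2)%:E * f y) =
    \int[g12]_(y in D12 i) f y).
  have K0 : 0 <= \int[g12]_(y in D12 i) f y by apply: integral_ge0.
  have c0 : 0 <= (c i)%:num%:E by rewrite lee_fin.
  have w0 : 0 <= (w i)%:num%:E by rewrite lee_fin.
  (* The integrand is [rad x.2 ^+ 2] times a constant, so the first plan enters only through its
     cell mass [m i]. *)
  rewrite (_ : \int[g01]_(x in D01 i) _ =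
    \int[g01]_(x in D01 i) ((rad x.2 ^+ 2)%:E *
      ((c i)%:num%:E * \int[g12]_(y in D12 i) f y +
       (w i)%:num%:E * f (unit_pt, cone_tip Om)))); last first.
    apply: eq_integral => x _.
    rewrite ge0_integralZl//; last 2 first.
    + exact: measurable_funTS.
    + by rewrite lee_fin sqr_ge0.
    by rewrite muleCA [X in _ + X]muleCA -ge0_muleDr// mule_ge0.
  rewrite ge0_integralZr//; last 3 first.
  + exact: measurable_funTS.
  + by move=> x _; rewrite lee_fin sqr_ge0.
  + by rewrite adde_ge0// mule_ge0.
  rewrite cell01 ge0_muleDr ?mule_ge0// [X in _ + X + _]muleA.
  rewrite [(m i)%:E * (w i)%:num%:E]muleC wm mul0e adde0.
  rewrite (_ : \int[g12]_(y in D12 i) (_ * _) = \int[g12]_(y in D12 i) f y).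
    rewrite muleA [_ * (c i)%:num%:E]muleC -ge0_muleDl ?cmw ?mul1e//.
    by apply: mule_ge0 => //; rewrite lee_fin.
  by apply: eq_integral => y _; rewrite ru expr1n mul1e.
- have r20 (z : C) : (0 <= rad z ^+ 2)%R by exact: sqr_ge0.
  have er0 t : (0 <= gluing_error t)%R.
    by apply: mulr_ge0; apply: mulr_ge0 => //; rewrite subr_ge0 cos_pi_le1.
  (* A crude bound for pairs with a Dirac partner, whose positions need not be close. *)
  have err4 t : (gluing_error t <= rad t.1.2 ^+ 2 * rad t.2.1 ^+ 2 * 4)%R.
    rewrite /gluing_error mulrC; apply: ler_wpM2l; first exact: mulr_ge0.
    by have := cos_pi_geN1 (body_dist (pos t.1.2) (pos t.2.1)); lra.
  have mer : measurable_fun setT gluing_error.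
    apply: measurable_funM; last first.
      apply: measurable_funM.
        apply/measurable_EFinP; exact: (measurableT_comp mrad2 measurable_fst).
      apply/measurable_EFinP; exact: (measurableT_comp mrad1 measurable_snd).
    apply: measurable_funM; first exact: measurable_cst.
    apply: measurable_funB; first exact: measurable_cst.
    apply: measurable_cos_pi; apply: measurable_body_dist.
      exact: (measurableT_comp measurable_snd measurable_fst).
    exact: (measurableT_comp measurable_fst measurable_snd).
  have m1 x : measurable_fun setT (fun y => (gluing_error (x, y))%:E).
    apply/measurable_EFinP.
    by apply: (measurableT_comp mer); exact: pair1_measurable.
  rewrite ME; [|exact/measurable_EFinP|by move=> t; rewrite lee_fin].
  rewrite [X in _ + X]big1 ?adde0; last first.
    move=> i _; apply/eqP; rewrite eq_le; apply/andP; split; last first.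
      by rewrite mule_ge0// integral_ge0// => y _; rewrite lee_fin.
    apply: (@le_trans _ _ ((w i)%:num%:E * (4 * m i)%:E)); last first.
      by rewrite EFinM muleCA wm mule0.
    rewrite lee_wpmul2l// EFinM -cell12 -ge0_integralZl//; last 2 first.
    + exact: measurable_funTS.
    + by move=> y _; rewrite lee_fin.
    apply: ge0_le_integral => //.
    + by move=> y _; rewrite lee_fin.
    + exact: measurable_funTS.
    + by apply: measurable_funTS; apply: measurable_funeM.
    + move=> y _; rewrite -EFinM lee_fin (le_trans (err4 _))//=.
      by rewrite ru expr1n mul1r mulrC.
  rewrite -total_mass ge0_sume_distrr; last by move=> i _; rewrite lee_fin.
  apply: lee_sum => i _.
  (* The constant factor is [e] on a positive cell and 4 on a null cell; integration multiplies it
     by [m i], which removes the latter. *)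
  apply: (@le_trans _ _ (\int[g01]_(x in D01 i) ((rad x.2 ^+ 2)%:E *
    ((c i)%:num%:E * (e * m i)%:E + (w i)%:num%:E * 4%:E)))); last first.
    rewrite ge0_integralZr//; last 3 first.
    + exact: measurable_funTS.
    + by move=> x _; rewrite lee_fin.
    + by rewrite adde_ge0// mule_ge0// lee_fin// mulr_ge0// ltW.
    rewrite cell01 -!EFinM lee_fin.
    have wm0 : ((w i)%:num * m i)%R = 0%R by apply: EFin_inj; rewrite EFinM.
    have cmw1 : ((c i)%:num * m i + (w i)%:num)%R = 1%R.
      by apply: EFin_inj; rewrite EFinD EFinM.
    rewrite [leLHS](_ : _ = e * m i * ((c i)%:num * m i + (w i)%:num) +
      (4 - e) * ((w i)%:num * m i))%R; last by ring.
    by rewrite wm0 cmw1 mulr0 mulr1 addr0.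
  apply: ge0_le_integral => //.
  + move=> x _; rewrite adde_ge0// mule_ge0//; last by rewrite lee_fin.
    by rewrite integral_ge0// => y _; rewrite lee_fin.
  + apply: measurable_funTS; apply: emeasurable_funD; apply: measurable_funeM.
      under eq_fun => x.
        rewrite -(integral_mrestr g12 (mD12 i)); [over|exact: m1|].
        by move=> y; rewrite lee_fin.
      apply: (@measurable_fun_fubini_tonelli_F _ _ _ _ _ (mrestr g12 (mD12 i))
        (EFin \o gluing_error)); first exact/measurable_EFinP.
      by move=> t; rewrite lee_fin.
    apply/measurable_EFinP.
    by apply: (measurableT_comp mer); exact: pair2_measurable.
  + by apply: measurable_funTS; apply: emeasurable_funM.
  move=> x Dx.
  have a1 : 0 <= (c i)%:num%:E * (e * m i)%:E.
    by apply: mule_ge0; rewrite lee_fin// mulr_ge0// ltW.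
  have a2 : 0 <= (w i)%:num%:E * 4%:E by apply: mule_ge0; rewrite lee_fin.
  rewrite (ge0_muleDr _ a1 a2).
  apply: leeD; last first.
    rewrite muleCA lee_wpmul2l// -EFinM lee_fin (le_trans (err4 _))//=.
    by rewrite ru expr1n mulr1.
  rewrite muleCA lee_wpmul2l// [(e * m i)%:E]EFinM -cell12 muleA.
  rewrite -ge0_integralZl//; last 3 first.
  + exact: measurable_funTS.
  + by move=> y _; rewrite lee_fin.
  + by rewrite mule_ge0 ?lee_fin// ltW.
  apply: ge0_le_integral => //.
  + by move=> y _; rewrite lee_fin.
  + exact: measurable_funTS.
  + by apply: measurable_funTS; apply: measurable_funeM.
  (* Both positions lie in [A i], so the smallness of the cells applies. *)
  move=> y Dy; rewrite -!EFinM lee_fin /gluing_error/=.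
  rewrite [(rad x.2 ^+ 2 * e)%R]mulrC -[leRHS]mulrA.
  by apply: ler_wpM2r; [exact: mulr_ge0|exact: Ae Dx Dy].
Qed.

End pieces.

(* The third property stands in for the disintegration in the usual gluing
   lemma: after rescaling, the two middle points are only close. *)
Lemma exists_gluing (e : R) : (0 < e)%R ->
  exists M : {finite_measure set ((C * C) * (C * C))%type -> \bar R},
    [/\ forall f, measurable_fun setT f -> (forall x, 0 <= f x) ->
          \int[M]_t ((rad t.2.1 ^+ 2)%:E * f t.1) = \int[g01]_x f x,
        forall f, measurable_fun setT f -> (forall y, 0 <= f y) ->
          \int[M]_t ((rad t.1.2 ^+ 2)%:E * f t.2) = \int[g12]_y f y &
        \int[M]_t (gluing_error t)%:E <= e%:E].
Proof.
move=> e0; pose m := fine (mu setT).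
have m0 : (0 <= m)%R by rewrite fine_ge0 ?measure_ge0.
have mE : mu setT = m%:E by rewrite fineK// ge0_fin_numE ?measure_ge0.
(* The added 1 keeps this bound positive when [mu] has mass zero. *)
have em0 : (0 < e / (m + 1))%R by rewrite divr_gt0// ltr_wpDl.
have [n [A [mA tA AT Ae]]] := body_partition Om em0.
have [M [M01 M12 Merr]] := exists_gluing_pieces mA tA AT em0 Ae.
exists M; split => //; apply: le_trans Merr _.
rewrite mE -EFinM lee_fin mulrAC ler_pdivrMr ?ltr_wpDl//.
by rewrite ler_wpM2l ?(ltW e0)// lerDl.
Qed.

End gluing.

(** * The triangle inequality *)

Section hk_triangle.
Local Open Scope ereal_scope.
Context {R : realType} {d : nat} (Om : convex_body R d).
Local Notation C := (cone Om).
Implicit Types mu : {measure set Om -> \bar R}.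

(** Weighted Cauchy-Schwarz. Integrated with [a], [b], [c] bounding the L2 norms of [x], [y], [z],
    it gives Minkowski's inequality. *)
Lemma sum_sqr_le (a b c x y z : R) : (0 < a)%R -> (0 < b)%R -> (0 < c)%R ->
  ((x + y + z) ^+ 2 <=
   (a + b + c) * (x ^+ 2 / a + y ^+ 2 / b + z ^+ 2 / c))%R.
Proof.
move=> a0 b0 c0; rewrite -subr_ge0.
rewrite (_ : _ - _ = a * b * (x / a - y / b) ^+ 2 + b * c * (y / b - z / c) ^+ 2 +
  a * c * (x / a - z / c) ^+ 2)%R; last by field; rewrite !gt_eqF.
by rewrite !addr_ge0// mulr_ge0 ?sqr_ge0// mulr_ge0// ltW.
Qed.

Lemma HK_le_glued mu0 mu1 mu2 (g01 g12 : {finite_measure set (C * C)%type -> \bar R})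
    (a b c : R) : (0 < a)%R -> (0 < b)%R -> (0 < c)%R ->
  mu0 setT < +oo -> mu1 setT < +oo -> mu2 setT < +oo ->
  (forall A, measurable A -> \int[g01]_x rad_sq_on A x.1 = mu0 A) ->
  (forall A, measurable A -> \int[g01]_x rad_sq_on A x.2 = mu1 A) ->
  (forall A, measurable A -> \int[g12]_y rad_sq_on A y.1 = mu1 A) ->
  (forall A, measurable A -> \int[g12]_y rad_sq_on A y.2 = mu2 A) ->
  transport_cost g01 <= (a ^+ 2)%:E -> transport_cost g12 <= (b ^+ 2)%:E ->
  HK mu0 mu2 <= (a + b + c)%:E.
Proof.
move=> a0 b0 c0 oo0 oo1 oo2 h0 h01 h12 h2 ca cb.
have c20 : (0 < c ^+ 2)%R by rewrite exprn_gt0.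
have [M [M01 M12 Merr]] := exists_gluing oo1 h01 h12 c20.
(* [(repr z).2] is the radius of [z] as a bundled nonnegative number. By [rad_sq_on_scale] this
   dilation produces the weight that appears in [M01]. *)
pose p (t : (C * C) * (C * C)) := cone_scale (repr t.2.1).2 t.1.1.
pose q (t : (C * C) * (C * C)) := cone_scale (repr t.1.2).2 t.2.2.
have m11 : measurable_fun setT (fun t : (C * C) * (C * C) => t.1.1).
  exact: (measurableT_comp measurable_fst measurable_fst).
have m12 : measurable_fun setT (fun t : (C * C) * (C * C) => t.1.2).
  exact: (measurableT_comp measurable_snd measurable_fst).
have m21 : measurable_fun setT (fun t : (C * C) * (C * C) => t.2.1).
  exact: (measurableT_comp measurable_fst measurable_snd).
have m22 : measurable_fun setT (fun t : (C * C) * (C * C) => t.2.2).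
  exact: (measurableT_comp measurable_snd measurable_snd).
have mp : measurable_fun setT p.
  apply: measurable_cone_scale => //.
  exact: (measurableT_comp (@measurable_rad R d Om) m21).
have mq : measurable_fun setT q.
  apply: measurable_cone_scale => //.
  exact: (measurableT_comp (@measurable_rad R d Om) m12).
have P0 A : measurable A -> \int[M]_t rad_sq_on A (p t) = mu0 A.
  move=> mA; rewrite -h0// -M01//.
  - by apply: eq_integral => t _; rewrite rad_sq_on_scale.
  - exact: (measurableT_comp (measurable_rad_sq_on mA) measurable_fst).
  - by move=> x; exact: rad_sq_on_ge0.
have P2 A : measurable A -> \int[M]_t rad_sq_on A (q t) = mu2 A.
  move=> mA; rewrite -h2// -M12//.
  - by apply: eq_integral => t _; rewrite rad_sq_on_scale.
  - exact: (measurableT_comp (measurable_rad_sq_on mA) measurable_snd).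
  - by move=> x; exact: rad_sq_on_ge0.
apply: le_trans (HK_le mp mq oo0 oo2 P0 P2) _.
have abc0 : (0 < a + b + c)%R by rewrite !addr_gt0.
have -> : (a + b + c)%:E = sqrte ((a + b + c) ^+ 2)%:E.
  by rewrite /= sqrtr_sqr gtr0_norm.
rewrite lee_sqrt ?lee_fin ?sqr_ge0//.
pose cost (x : C * C) : \bar R := (cone_dist x.1 x.2 ^+ 2)%:E.
have mcost : measurable_fun setT cost.
  apply/measurable_EFinP/measurable_funX.
  by apply: measurable_cone_dist; [exact: measurable_fst|exact: measurable_snd].
have cost0 x : 0 <= cost x by rewrite lee_fin sqr_ge0.
pose X (t : (C * C) * (C * C)) := (rad t.2.1 ^+ 2)%:E * cost t.1.
pose Z (t : (C * C) * (C * C)) := (rad t.1.2 ^+ 2)%:E * cost t.2.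
have mX : measurable_fun setT X.
  apply: emeasurable_funM; first exact: measurable_rad_sqr.
  exact: (measurableT_comp mcost measurable_fst).
have mZ : measurable_fun setT Z.
  apply: emeasurable_funM; first exact: measurable_rad_sqr.
  exact: (measurableT_comp mcost measurable_snd).
have mY : measurable_fun setT (fun t => (@gluing_error R d Om t)%:E).
  apply/measurable_EFinP; apply: measurable_funM; last first.
    by apply: measurable_funM; apply/measurable_EFinP; exact: measurable_rad_sqr.
  apply: measurable_funM; first exact: measurable_cst.
  apply: measurable_funB; first exact: measurable_cst.
  by apply: measurable_cos_pi; exact: measurable_body_dist.
have X0 t : 0 <= X t by rewrite mule_ge0// lee_fin sqr_ge0.
have Z0 t : 0 <= Z t by rewrite mule_ge0// lee_fin sqr_ge0.
have Y0 (t : (C * C) * (C * C)) : 0 <= (gluing_error t)%:E.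
  rewrite lee_fin /gluing_error.
  apply: mulr_ge0; apply: mulr_ge0 => //; rewrite ?sqr_ge0//.
  by rewrite subr_ge0 cos_pi_le1.
have k0 (k : R) : (0 < k)%R -> 0 <= ((a + b + c) / k)%:E.
  by move=> k0; rewrite lee_fin divr_ge0// ltW.
apply: (@le_trans _ _ (\int[M]_t (((a + b + c) / a)%:E * X t +
    ((a + b + c) / b)%:E * Z t + ((a + b + c) / c)%:E * (gluing_error t)%:E))).
  apply: ge0_le_integral => //.
  - by move=> t _; rewrite lee_fin sqr_ge0.
  - by apply/measurable_EFinP; apply: measurable_funX; exact: measurable_cone_dist.
  - by do 2 (apply: emeasurable_funD; last exact: measurable_funeM);
      exact: measurable_funeM.
  move=> [[z0 z1] [z1' z2]] _; rewrite /X /Z /cost -!EFinM -!EFinD lee_fin/=.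
  have -> : gluing_error ((z0, z1), (z1', z2)) =
      (cone_dist (cone_scale (repr z1').2 z1) (cone_scale (repr z1).2 z1') ^+ 2)%R.
    rewrite cone_dist_ptE sqr_sqrtr; last first.
      by rewrite cone_dist_sq_ge0// mulr_ge0 ?ge0 ?rad_ge0.
    by rewrite /cone_dist_sq /gluing_error /= -/(rad z1) -/(rad z1'); ring.
  set Y := cone_dist (cone_scale _ z1) _.
  set x := cone_dist z0 z1; set z := cone_dist z1' z2.
  apply: (@le_trans _ _ ((rad z1' * x + rad z1 * z + Y) ^+ 2)%R).
    rewrite ler_sqr ?nnegrE ?sqrtr_ge0//; last first.
      by rewrite !addr_ge0 ?mulr_ge0 ?rad_ge0// sqrtr_ge0.
    (* The path passes through the two dilated middle points; its outer legs are dilated legs of the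
       plans, its middle leg is the gluing error. *)
    apply: (le_trans (cone_dist_triangle_ineq (cone_scale (repr z1').2 z1) _ _)).
    rewrite cone_dist_scale -addrA lerD2l.
    apply: (le_trans (cone_dist_triangle_ineq (cone_scale (repr z1).2 z1') _ _)).
    by rewrite cone_dist_scale addrC.
  apply: le_trans (sum_sqr_le _ _ _ a0 b0 c0) _.
  by rewrite le_eqVlt; apply/orP; left; apply/eqP; ring.
rewrite ge0_integralD//; last 4 first.
- by move=> t _; rewrite adde_ge0// mule_ge0// k0.
- by apply: emeasurable_funD; exact: measurable_funeM.
- by move=> t _; rewrite mule_ge0// k0.
- exact: measurable_funeM.
rewrite ge0_integralD//; last 4 first.
- by move=> t _; rewrite mule_ge0// k0.
- exact: measurable_funeM.
- by move=> t _; rewrite mule_ge0// k0.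
- exact: measurable_funeM.
rewrite !ge0_integralZl ?k0//.
(* The three integrals are bounded by [a ^+ 2], [b ^+ 2] and [c ^+ 2]. *)
have -> : ((a + b + c) ^+ 2)%:E = ((a + b + c) / a)%:E * (a ^+ 2)%:E +
    ((a + b + c) / b)%:E * (b ^+ 2)%:E + ((a + b + c) / c)%:E * (c ^+ 2)%:E.
  by rewrite -!EFinM -!EFinD; congr EFin; field; rewrite !gt_eqF.
apply: leeD; first apply: leeD.
- by rewrite lee_wpmul2l ?k0// /X M01.
- by rewrite lee_wpmul2l ?k0// /Z M12.
- by rewrite lee_wpmul2l ?k0.
Qed.

Lemma HK_ge0 mu0 mu1 : 0 <= HK mu0 mu1.
Proof.
apply: le_ereal_inf_tmp => _ [l0 [l1 [_ _ ->]]]; exact: sqrte_ge0.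
Qed.

Lemma HK_triangle mu1 mu0 mu2 : HK mu0 mu2 <= HK mu0 mu1 + HK mu1 mu2.
Proof.
have := HK_ge0 mu0 mu1; have := HK_ge0 mu1 mu2.
case E12 : (HK mu1 mu2) => [y| |]//; case E01 : (HK mu0 mu1) => [x| |]//.
- rewrite !lee_fin => y0 x0; apply/lee_addgt0Pr => e e0.
  (* One third for each near-optimal plan and one for the gluing error; it also keeps the weights
     positive when a distance is zero. *)
  have e30 : (0 < e / 3)%R by rewrite divr_gt0.
  have [|g01 [h0 h01 oo0 oo1 c01]] := @HK_lt_plan _ _ _ mu0 mu1 (x + e / 3).
    by rewrite E01 lte_fin ltrDl.
  have [|g12 [h12 h2 _ oo2 c12]] := @HK_lt_plan _ _ _ mu1 mu2 (y + e / 3).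
    by rewrite E12 lte_fin ltrDl.
  have a0 : (0 < x + e / 3)%R by rewrite ltr_wpDl.
  have b0 : (0 < y + e / 3)%R by rewrite ltr_wpDl.
  apply: le_trans (HK_le_glued a0 b0 e30 oo0 oo1 oo2 h0 h01 h12 h2 c01 c12) _.
  by rewrite -!EFinD lee_fin; lra.
- by move=> *; rewrite leey.
- by move=> *; rewrite addey// leey.
- by move=> *; rewrite leey.
Qed.

End hk_triangle.

(** * The interpolating curve *)

Section interpolation_curve.
Local Open Scope ereal_scope.
Context {R : realType} {d : nat} (Om : convex_body R d).
Local Notation C := (cone Om).
Implicit Types (g : {finite_measure set (C * C)%type -> \bar R}) (s t : {i01 R}).

Lemma cone_proj_interpE s g (A : set Om) : measurable A ->
  cone_proj (interp s g) A = \int[g]_z rad_sq_on A (geod s z.1 z.2).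
Proof.
move=> mA; rewrite cone_projE.
apply: (ge0_integral_pushforward (@measurable_geod R d Om s) g measurableT).
  exact: measurable_rad_sq_on.
by move=> z _; exact: rad_sq_on_ge0.
Qed.

(** The difference is a sum of nonnegative terms. The bound passes the second moment of a plan on to
    its interpolants. *)
Lemma rad_geod_sqr_le s (z w : C) : (rad (geod s z w) ^+ 2 <= rad z ^+ 2 + rad w ^+ 2)%R.
Proof.
have s01 : (0 <= s%:num <= 1)%R by apply/andP.
rewrite [rad (geod s z w)]rad_pt/= geo_rad_sqr ?s01 ?ge0//.
rewrite -/(rad z) -/(rad w) -[body_dist _ _]/(body_dist (pos z) (pos w)).
have := cos_pi_le1 (body_dist (pos z) (pos w)); set k := cos_pi _ => k1.
set u := s%:num in s01 *; have /andP[u0 u1] := s01.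
have z0 := rad_ge0 z; have w0 := rad_ge0 w.
have h1 : (0 <= 2 * u * (1 - u) * rad z * rad w * (1 - k))%R.
  by rewrite !mulr_ge0 ?subr_ge0//.
have h2 : (0 <= u * (1 - u) * (rad z - rad w) ^+ 2)%R.
  by apply: mulr_ge0; [rewrite mulr_ge0 ?subr_ge0|exact: sqr_ge0].
have h3 : (0 <= u * rad z ^+ 2)%R by rewrite mulr_ge0 ?sqr_ge0//.
have h4 : (0 <= (1 - u) * rad w ^+ 2)%R by rewrite mulr_ge0 ?sqr_ge0 ?subr_ge0//.
rewrite -subr_ge0.
rewrite (_ : _ - _ = 2 * u * (1 - u) * rad z * rad w * (1 - k) +
  u * (1 - u) * (rad z - rad w) ^+ 2 + u * rad z ^+ 2 + (1 - u) * rad w ^+ 2)%R.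
  by rewrite !addr_ge0.
by ring.
Qed.

Lemma measurable_rad_sqr_sum :
  measurable_fun setT (fun z : C * C => (rad z.1 ^+ 2 + rad z.2 ^+ 2)%:E).
Proof.
exact: (emeasurable_funD (measurable_rad_sqr measurable_fst)
  (measurable_rad_sqr measurable_snd)).
Qed.

Lemma cone_proj_interp_fin s g : moment2_prod g ->
  cone_proj (interp s g) setT < +oo.
Proof.
move=> gm; rewrite cone_proj_interpE//; apply: le_lt_trans gm.
apply: ge0_le_integral => //.
- by move=> z _; exact: rad_sq_on_ge0.
- exact: (measurableT_comp (measurable_rad_sq_on measurableT)
    (@measurable_geod R d Om s)).
- exact: measurable_rad_sqr_sum.
- by move=> z _; rewrite rad_sq_onT lee_fin rad_geod_sqr_le.
Qed.

Lemma transport_cost_fin g : moment2_prod g -> transport_cost g \is a fin_num.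
Proof.
move=> gm; rewrite ge0_fin_numE; last first.
  by apply: integral_ge0 => z _; rewrite lee_fin sqr_ge0.
have mrr : measurable_fun setT
    (fun z : C * C => (rad z.1 ^+ 2 + rad z.2 ^+ 2)%:E).
  exact: measurable_rad_sqr_sum.
apply: (@le_lt_trans _ _ (2%:E * \int[g]_z (rad z.1 ^+ 2 + rad z.2 ^+ 2)%:E)).
  rewrite -ge0_integralZl//; last first.
    by move=> z _; rewrite lee_fin addr_ge0 ?sqr_ge0.
  apply: ge0_le_integral => //.
  - by move=> z _; rewrite lee_fin sqr_ge0.
  - apply/measurable_EFinP/measurable_funX.
    by apply: measurable_cone_dist; [exact: measurable_fst|exact: measurable_snd].
  - exact: measurable_funeM.
  - by move=> z _; rewrite -EFinM lee_fin cone_dist_sqr_le.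
by rewrite lte_mul_pinfty// lee_fin.
Qed.

(** Agreement on measurable sets is all that is asked of [mu] and [mu'], so that the given endpoint
    measures can be used as well as the interpolants. *)
Lemma HK_geod_le s t g (mu mu' : {measure set Om -> \bar R}) :
  moment2_prod g ->
  (forall A, measurable A -> mu A = cone_proj (interp s g) A) ->
  (forall A, measurable A -> mu' A = cone_proj (interp t g) A) ->
  HK mu mu' <= (`|s%:num - t%:num|)%:E * sqrte (transport_cost g).
Proof.
move=> gm muE mu'E; have mg := @measurable_geod R d Om.
have Ig0 : 0 <= transport_cost g.
  by apply: integral_ge0 => z _; rewrite lee_fin sqr_ge0.
apply: le_trans (HK_le (mg s) (mg t) _ _ _ _) _.
- by rewrite muE//; exact: cone_proj_interp_fin.
- by rewrite mu'E//; exact: cone_proj_interp_fin.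
- by move=> A mA; rewrite (muE A mA); apply/esym; exact: cone_proj_interpE.
- by move=> A mA; rewrite (mu'E A mA); apply/esym; exact: cone_proj_interpE.
rewrite (_ : \int[g]_z _ = (`|s%:num - t%:num| ^+ 2)%:E * transport_cost g).
  by rewrite sqrteM ?lee_fin ?sqr_ge0//= sqrtr_sqr normr_id.
rewrite /transport_cost -ge0_integralZl//; last 2 first.
- apply/measurable_EFinP/measurable_funX.
  by apply: measurable_cone_dist; [exact: measurable_fst|exact: measurable_snd].
- by move=> z _; rewrite lee_fin sqr_ge0.
by apply: eq_integral => z _; rewrite -EFinM cone_dist_geod exprMn.
Qed.

End interpolation_curve.

(** * Equality along the curve *)

Unset Implicit Arguments.

Theorem theorem3p11 (R : realType) (d : nat) (Om : convex_body R d)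
    (mu0 mu1 : {finite_measure set Om -> \bar R})
    (lambda0 lambda1 : {finite_measure set (cone Om) -> \bar R})
    (gamma : {finite_measure set (cone Om * cone Om)%type -> \bar R}) :
  optimal_lifts mu0 mu1 lambda0 lambda1 ->
  moment2_prod gamma ->
  optimal_plan lambda0 lambda1 gamma ->
  forall s t : {i01 R}, s%:num < t%:num ->
    HK (cone_proj (interp s gamma)) (cone_proj (interp t gamma)) =
    (`|t%:num - s%:num|%:E * HK mu0 mu1)%E.
Proof.
move=> [L0 L1 lopt] gm [gc gopt] s t st.
pose o : {i01 R} := Itv01 (lexx 0) ler01.
pose i : {i01 R} := Itv01 ler01 (lexx 1).
have mu0E A : measurable A -> mu0 A = cone_proj (interp o gamma) A.
  move=> mA; rewrite cone_proj_interpE// -L0.2// cone_projE.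
  have [<- _] := integral_coupling gc (measurable_rad_sq_on mA) (rad_sq_on_ge0 A).
  by apply: eq_integral => z _; rewrite geod0.
have mu1E A : measurable A -> mu1 A = cone_proj (interp i gamma) A.
  move=> mA; rewrite cone_proj_interpE// -L1.2// cone_projE.
  have [_ <-] := integral_coupling gc (measurable_rad_sq_on mA) (rad_sq_on_ge0 A).
  by apply: eq_integral => z _; rewrite geod1.
have Ig0 : (0 <= transport_cost gamma)%E.
  by apply: integral_ge0 => z _; rewrite lee_fin sqr_ge0.
(* The upper bound is [HK_geod_le] between the parameters 0 and 1; the lower bound combines
   optimality of the lifts with that of the plan. *)
have HKE : HK mu0 mu1 = sqrte (transport_cost gamma).
  apply/le_anti/andP; split.
    have := HK_geod_le gm mu0E mu1E.
    by rewrite /= sub0r normrN normr1 mul1e.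
  apply: le_ereal_inf_tmp => _ [l0 [l1 [l0P l1P ->]]].
  apply: le_trans (lopt _ _ l0P l1P).
  rewrite lee_sqrt; apply: le_ereal_inf_tmp => _ [g' g'P <-]; first exact: gopt.
  by apply: integral_ge0 => z _; rewrite lee_fin sqr_ge0.
have sqr_fin : sqrte (transport_cost gamma) \is a fin_num.
  by rewrite sqrte_fin_num// transport_cost_fin.
pose k := fine (sqrte (transport_cost gamma)).
have kE : sqrte (transport_cost gamma) = k%:E by rewrite fineK.
have muE u A (_ : measurable A) := erefl (cone_proj (interp u gamma) A).
have le_st := HK_geod_le gm (muE s) (muE t).
have le_0s := HK_geod_le gm mu0E (muE s).
have le_t1 := HK_geod_le gm (muE t) mu1E.
have s0 : 0 <= s%:num by [].
have t1 : t%:num <= 1 by [].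
move: le_st le_0s le_t1; rewrite HKE kE -!EFinM.
set X := HK (cone_proj (interp s gamma)) _.
set Y := HK mu0 _; set Z := HK _ mu1; rewrite /= => XE YE ZE.
have X0 : (0 <= X)%E by exact: HK_ge0.
have tri : (k%:E <= Y + (X + Z))%E.
  rewrite -kE -HKE.
  apply: le_trans (HK_triangle (cone_proj (interp s gamma)) _ _) _.
  by rewrite leeD2l// HK_triangle.
have {tri YE ZE} : (k%:E <= (`|0 - s%:num| * k)%:E + (X + (`|t%:num - 1| * k)%:E))%E.
  by apply: le_trans tri _; rewrite leeD// leeD2l.
have s_norm : `|0 - s%:num| = s%:num by rewrite sub0r normrN ger0_norm.
have t_norm : `|t%:num - 1| = 1 - t%:num by rewrite distrC ger0_norm// subr_ge0.
have st_norm : `|t%:num - s%:num| = t%:num - s%:num.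
  by rewrite gtr0_norm// subr_gt0.
rewrite s_norm t_norm; rewrite distrC st_norm in XE; rewrite st_norm.
(* [X] is finite by its bounds, so [s * k] and [(1 - t) * k] can be cancelled from the triangle
   inequality, leaving [(t - s) * k <= X]. *)
move: X0 XE; case: X => [x| |]//; rewrite -?EFinD ?lee_fin => x0 xle xge.
by congr EFin; apply/le_anti/andP; split => //; nra.
Qed.
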